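(* Weighted coloured token swapping on a star is solved optimally by the following algorithm: construct the token-vertex assignment $T_A$ (assign each leaf loop's token to its own vertex; for each connected component of $G'$ choose an Eulerian circuit, and if its edges in circuit order are labelled by star vertices $v_1,\dots,v_b$, with $t_i$ the initial token of $v_i$, assign $t_i$ to $v_{i+1}$, indices modulo $b$), and then compute a minimum-cost swap sequence for the weighted uncoloured instance defined by $T_A$. That is, $F(T_A)=\min_T F(T)$ over all token-vertex assignments $T$, and this minimum is the minimum cost of the weighted coloured instance; in particular the problem is solvable in polynomial time.
   Context: Weighted coloured token swapping on a star: a star (tree with one non-leaf vertex $u$, the center); each vertex has a colour and carries one coloured token initially, with equally many tokens and vertices of each colour; each colour $c$ has a positive weight $w(c)$, and swapping tokens of colours $c,c'$ costs $w(c)+w(c')$; the goal is a minimum-cost swap sequence after which each token is on a vertex of its own colour. A token-vertex assignment $T$ is a colour-preserving bijection from tokens to vertices, defining an uncoloured weighted instance where each token must reach its assigned vertex; $F(T)$ is the minimum cost of a swap sequence solving that instance. The directed multigraph $G$ has the colours as vertices and, for each star vertex $v$ of colour $c$ whose initial token has colour $d$, a directed edge $c\to d$ labelled $v$. A leaf loop is a loop labelled by a leaf. $G'$ is $G$ with all leaf loops removed; every vertex of $G'$ has in-degree equal to out-degree, so each connected component with edges has an Eulerian circuit. An edge labelled $v_i$ goes from the colour of $v_i$ to the colour of its initial token, so consecutive edges in a circuit make $t_i$ and $v_{i+1}$ have the same colour. *)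

(* Defs.v *)
From HB Require Import structures.
From mathcomp Require Import all_boot all_order all_algebra all_fingroup.

Set Implicit Arguments.
Unset Strict Implicit.
Unset Printing Implicit Defensive.

Import Order.TTheory GRing.Theory Num.Theory.
Local Open Scope ring_scope.

(** * Stars *)

Definition leaf (V : finType) (e : rel V) (v : V) : bool :=
  #|[set w | e v w]| == 1%N.

(* A cycle of a simple graph has at least three vertices: [:: x; y] satisfies
   [ucycle e] as soon as x and y are adjacent. *)
Definition is_tree (V : finType) (e : rel V) : Prop :=
  [/\ symmetric e, irreflexive e, (forall x y, connect e x y)
    & forall c : seq V, ucycle e c -> (size c <= 2)%N].

Definition is_star (V : finType) (e : rel V) (u : V) : Prop :=
  is_tree e /\ forall v, ~~ leaf e v = (v == u).

(** * Weighted coloured token swapping *)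

(* V is the set of vertices and C the set of colours.  A token is identified
   with the vertex that carries it initially, so [tcol v] is the colour of the
   initial token of v. *)
Record instance (R : realFieldType) (V C : finType) := Instance {
  adj : rel V;
  centre : V;
  vcol : V -> C;
  tcol : V -> C;
  weight : C -> R
}.

Definition star_instance (R : realFieldType) (V C : finType)
    (I : instance R V C) : Prop :=
  [/\ is_star (adj I) (centre I),
      (forall c, #|[set v | tcol I v == c]| = #|[set v | vcol I v == c]|)
    & forall c, 0 < weight I c].

(* A placement s maps each vertex to the token it currently carries; the
   initial placement is the identity. *)
Definition swap (V : finType) (x y : V) (s : {perm V}) : {perm V} :=
  (tperm x y * s)%g.

Fixpoint run (V : finType) (s : {perm V}) (sigma : seq (V * V)) : {perm V} :=
  if sigma is e :: sigma' then run (swap e.1 e.2 s) sigma' else s.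

Fixpoint cost_from (R : realFieldType) (V C : finType) (I : instance R V C)
    (s : {perm V}) (sigma : seq (V * V)) : R :=
  if sigma is e :: sigma' then
    weight I (tcol I (s e.1)) + weight I (tcol I (s e.2))
      + cost_from I (swap e.1 e.2 s) sigma'
  else 0.

Definition cost (R : realFieldType) (V C : finType) (I : instance R V C)
    (sigma : seq (V * V)) : R := cost_from I 1%g sigma.

Definition swap_sequence (R : realFieldType) (V C : finType)
    (I : instance R V C) (sigma : seq (V * V)) : bool :=
  all (fun e => adj I e.1 e.2) sigma.

Definition solves_coloured (R : realFieldType) (V C : finType)
    (I : instance R V C) (sigma : seq (V * V)) : Prop :=
  swap_sequence I sigma /\ forall v, tcol I (run 1%g sigma v) = vcol I v.

(* The uncoloured instance defined by T : the token t must reach T t. *)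
Definition solves_uncoloured (R : realFieldType) (V C : finType)
    (I : instance R V C) (T : V -> V) (sigma : seq (V * V)) : Prop :=
  swap_sequence I sigma /\ forall v, T (run 1%g sigma v) = v.

Definition is_minimum (R : realFieldType) (A : R -> Prop) (m : R) : Prop :=
  A m /\ forall x, A x -> m <= x.

Definition min_cost (R : realFieldType) (V C : finType) (I : instance R V C)
    (solves : seq (V * V) -> Prop) (m : R) : Prop :=
  is_minimum (fun x => exists2 sigma, solves sigma & cost I sigma = x) m.

Definition optimal (R : realFieldType) (V C : finType) (I : instance R V C)
    (solves : seq (V * V) -> Prop) (sigma : seq (V * V)) : Prop :=
  solves sigma /\ forall sigma', solves sigma' -> cost I sigma <= cost I sigma'.

Definition token_vertex_assignment (R : realFieldType) (V C : finType)
    (I : instance R V C) (T : V -> V) : Prop :=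
  bijective T /\ forall t, vcol I (T t) = tcol I t.

(* [Fcost I T x] reads F(T) = x; a minimum is unique when it exists. *)
Definition Fcost (R : realFieldType) (V C : finType) (I : instance R V C)
    (T : V -> V) (x : R) : Prop := min_cost I (solves_uncoloured I T) x.

(** * The multigraph G and the assignment T_A *)

(* The edges of G are labelled by the vertices of the star: the edge labelled v
   goes from the colour [vcol I v] to the colour [tcol I v]. *)
Definition leaf_loop (R : realFieldType) (V C : finType) (I : instance R V C)
    (v : V) : bool := leaf (adj I) v && (vcol I v == tcol I v).

Definition G'_edges (R : realFieldType) (V C : finType) (I : instance R V C) :
  {set V} := [set v | ~~ leaf_loop I v].

Definition G'_adj (R : realFieldType) (V C : finType) (I : instance R V C) :
    rel C := fun c d =>
  [exists v in G'_edges I, ((vcol I v == c) && (tcol I v == d))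
                        || ((vcol I v == d) && (tcol I v == c))].

Definition G'_component (R : realFieldType) (V C : finType)
    (I : instance R V C) (c : C) : {set C} := [set d | connect (G'_adj I) c d].

Definition eulerian_circuit (R : realFieldType) (V C : finType)
    (I : instance R V C) (K : {set C}) (s : seq V) : Prop :=
  [/\ uniq s, s =i [set v in G'_edges I | vcol I v \in K]
    & path.cycle (fun v w => tcol I v == vcol I w) s].

(* T is a possible value of T_A.  Components are quantified through their
   elements; a component without edges has the empty circuit.  [next] is cyclic
   and, s being duplicate-free, maps v_i to v_(i+1). *)
Definition is_TA (R : realFieldType) (V C : finType) (I : instance R V C)
    (T : V -> V) : Prop :=
  (forall v, leaf_loop I v -> T v = v) /\
  (forall c, exists2 s, eulerian_circuit I (G'_component I c) s
                      & forall v, v \in s -> T v = next s v).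

(** * Polynomial time *)

(* Programs are systems of mutually recursive first-order functions over binary
   trees (the language F of N. D. Jones, "Computability and Complexity from a
   Programming Perspective"), where trees may also have weights as atoms.  Every
   elementary operation takes one unit of time.  The arithmetic is limited to
   addition, subtraction and comparison: without multiplication, t steps
   increase the bit length of the numbers by at most O(t), so that a polynomial
   bound on the number of steps gives polynomial time on a Turing machine when
   the weights are rationals written in binary. *)
Inductive data (R : Type) :=
  | DNil
  | DNum of R
  | DPair of data R & data R.

Arguments DNil {R}.

Inductive expr :=
  | EVar of nat
  | ENil
  | EPair of expr & expr
  | EFst of expr
  | ESnd of expr
  | EAdd of expr & expr
  | ESub of expr & expr
  | ELe of expr & expr
  | EIf of expr & expr & expr
  | ELet of expr & expr
  | ECall of nat & expr.

(* The i-th item is the body of function i, whose argument is variable 0. *)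
Definition program := seq expr.

Definition dfst (R : Type) (x : data R) : data R :=
  if x is DPair a _ then a else DNil.

Definition dsnd (R : Type) (x : data R) : data R :=
  if x is DPair _ b then b else DNil.

Definition dtrue (R : Type) (x : data R) : bool :=
  if x is DNil then false else true.

Definition dbool (R : Type) (b : bool) : data R :=
  if b then DPair DNil DNil else DNil.

Definition dadd (R : realFieldType) (x y : data R) : data R :=
  match x, y with DNum a, DNum b => DNum (a + b) | _, _ => DNil end.

Definition dsub (R : realFieldType) (x y : data R) : data R :=
  match x, y with DNum a, DNum b => DNum (a - b) | _, _ => DNil end.

Definition dle (R : realFieldType) (x y : data R) : data R :=
  match x, y with DNum a, DNum b => dbool R (a <= b) | _, _ => DNil end.

(* [eval p env e x t] : in the program p and the environment env (variables are
   de Bruijn indices), e evaluates to x in time t. *)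
Inductive eval (R : realFieldType) (p : program) :
    seq (data R) -> expr -> data R -> nat -> Prop :=
  | eval_var env i : eval p env (EVar i) (nth DNil env i) 1%N
  | eval_nil env : eval p env ENil DNil 1%N
  | eval_pair env e1 e2 x1 x2 t1 t2 :
      eval p env e1 x1 t1 -> eval p env e2 x2 t2 ->
      eval p env (EPair e1 e2) (DPair x1 x2) (t1 + t2)%N.+1
  | eval_fst env e x t :
      eval p env e x t -> eval p env (EFst e) (dfst x) t.+1
  | eval_snd env e x t :
      eval p env e x t -> eval p env (ESnd e) (dsnd x) t.+1
  | eval_add env e1 e2 x1 x2 t1 t2 :
      eval p env e1 x1 t1 -> eval p env e2 x2 t2 ->
      eval p env (EAdd e1 e2) (dadd x1 x2) (t1 + t2)%N.+1
  | eval_sub env e1 e2 x1 x2 t1 t2 :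
      eval p env e1 x1 t1 -> eval p env e2 x2 t2 ->
      eval p env (ESub e1 e2) (dsub x1 x2) (t1 + t2)%N.+1
  | eval_le env e1 e2 x1 x2 t1 t2 :
      eval p env e1 x1 t1 -> eval p env e2 x2 t2 ->
      eval p env (ELe e1 e2) (dle x1 x2) (t1 + t2)%N.+1
  | eval_if env e1 e2 e3 x1 x t1 t :
      eval p env e1 x1 t1 -> eval p env (if dtrue x1 then e2 else e3) x t ->
      eval p env (EIf e1 e2 e3) x (t1 + t)%N.+1
  | eval_let env e1 e2 x1 x t1 t :
      eval p env e1 x1 t1 -> eval p (x1 :: env) e2 x t ->
      eval p env (ELet e1 e2) x (t1 + t)%N.+1
  | eval_call env f e x1 x t1 t :
      eval p env e x1 t1 -> eval p [:: x1] (nth ENil p f) x t ->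
      eval p env (ECall f e) x (t1 + t)%N.+1.

Definition computes (R : realFieldType) (p : program) (x y : data R)
    (t : nat) : Prop := eval p [:: x] (nth ENil p 0%N) y t.

Definition enc_nat (R : Type) (n : nat) : data R :=
  iter n (DPair DNil) DNil.

Definition enc_seq (R : Type) (s : seq (data R)) : data R :=
  foldr (@DPair R) DNil s.

Definition enc_elt (R : Type) (X : finType) (x : X) : data R :=
  enc_nat R (enum_rank x).

(* A star is determined by its vertices and its centre, so its edges need not be
   part of the input. *)
Definition enc_instance (R : realFieldType) (V C : finType)
    (I : instance R V C) : data R :=
  DPair (enc_elt R (centre I))
    (DPair (enc_seq [seq DPair (enc_elt R (vcol I v)) (enc_elt R (tcol I v))
                    | v <- enum V])
           (enc_seq [seq DNum (weight I c) | c <- enum C])).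

Definition enc_swaps (R : Type) (V : finType) (sigma : seq (V * V)) : data R :=
  enc_seq [seq DPair (enc_elt R e.1) (enc_elt R e.2) | e <- sigma].

(* The time is bounded in terms of the numbers of vertices and of colours, not
   of the weights. *)
Definition polynomial_time_solvable : Prop :=
  exists (p : program) (k : nat),
  forall (R : realFieldType) (V C : finType) (I : instance R V C),
  star_instance I ->
  exists (sigma : seq (V * V)) (t : nat),
    [/\ optimal I (solves_coloured I) sigma,
        computes p (enc_instance I) (enc_swaps R sigma) t
      & (t <= k * (#|V| + #|C|) ^ k + k)%N].

(* Main.v *)
Require Import Defs.
From HB Require Import structures.
From mathcomp Require Import all_boot all_order all_algebra all_fingroup.
From mathcomp Require Import ring lra zify.

(** Every swap exchanges the token of the centre with a token of a leaf, so that
    the cost is, up to a constant, twice the total weight of the tokens that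
    arrive at the centre.  Each misplaced leaf token arrives at least once.  The
    first swap with a leaf of a component of G' other than that of the centre
    leaves a foreign token there, which must arrive once more; if k components
    are to be opened, these additional arrivals weigh at least the minimum of
    k m0, m0 + (k - 1) g and m0 + (k + 1) f, where m0, g, f are the least weights
    of a token in the component of the centre, in the other components, and on a
    leaf loop.  Only the components of G' enter this bound, and it is attained
    as soon as each component is a single cycle: solve the cycle of the centre
    and, when its lightest token is at the centre, solve the other cycles,
    either directly or from a lighter token fetched from another cycle or from
    a leaf loop.  The polynomial-time program computes Eulerian circuits with
    Hierholzer's algorithm and then the swaps just described. *)

Set Implicit Arguments.
Unset Strict Implicit.
Unset Printing Implicit Defensive.

Import Order.TTheory GRing.Theory Num.Theory.
Local Open Scope ring_scope.

(** * Swaps on a star and the lower bound *)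

(** The three bounds count who waits. In the first, the lightest token of the centre's component is
    parked once in each of the k components. In the second it is parked once, in the component with
    the token of weight g, which then waits for the k - 1 others. In the third it is parked on a
    leaf loop, whose token of weight f is parked k times; the first arrival of that token is extra
    too, since it was already home, hence k + 1. The obstacle is that an arbitrary sequence may
    change the waiting token at will and interleave components, so that strategies cannot be
    compared one by one. The lower bound is therefore an induction on the sequence, with a potential
    that depends only on the set of components already opened. A leaf loop whose colour lies in a
    component gets the label of that component, being no lighter than its lightest token; all
    colours met by no circuit share a single label. *)

Lemma star_adjE (V : finType) (e : rel V) (u : V) : is_star e u ->
  forall x y, e x y = (x != y) && ((x == u) || (y == u)).
Proof.
move=> [[sym irr con _] lf].
have nbr x : x != u -> exists y, forall z, e x z = (z == y).
  move=> xu; have := lf x; rewrite (negPf xu) => /negbFE.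
  rewrite /leaf => /cards1P[y /setP Ny]; exists y => z.
  by have := Ny z; rewrite !inE.
have adju x : x != u -> e x u.
  move=> xu; have [y Ny] := nbr x xu.
  have [->|yu] := eqVneq u y; first by rewrite Ny.
  (* If the neighbour [y] of [x] is not [u], both are leaves joined only to each other, so the pair
     is closed under adjacency and cannot be connected to [u]. *)
  have [z Nz] := nbr y (ltac:(by rewrite eq_sym)).
  have zx : x = z by apply/eqP; rewrite -Nz sym Ny.
  have cl : closed e (mem [:: x; y]).
    apply: intro_closed; first exact: sym_connect_sym.
    move=> a b eab; rewrite !inE => /orP[/eqP ax|/eqP ay].
      by rewrite ax Ny in eab; rewrite eab orbT.
    by rewrite ay Nz -zx in eab; rewrite eab.
  have := closed_connect cl (con x u).
  by rewrite !inE eqxx (eq_sym u x) (negPf xu) (negPf yu).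
move=> x y; have [->|xy] /= := eqVneq x y; first exact: irr.
have [xu|xu] /= := eqVneq x u.
  by rewrite xu sym adju // -xu eq_sym.
have [z Nz] := nbr x xu.
have := Nz u; rewrite adju // => /esym/eqP uz.
by rewrite Nz uz.
Qed.

Lemma star_leafE (V : finType) (e : rel V) (u v : V) : is_star e u ->
  leaf e v = (v != u).
Proof. by move=> [_ lf]; rewrite -lf negbK. Qed.

Definition centre_swaps (V : finType) (u : V) (ls : seq V) : seq (V * V) :=
  [seq (u, l) | l <- ls].

Lemma run_cat (V : finType) (s : {perm V}) (a b : seq (V * V)) :
  run s (a ++ b) = run (run s a) b.
Proof. by elim: a s => //= e a IH s. Qed.

Lemma run_mul (V : finType) (s : {perm V}) (a : seq (V * V)) :
  run s a = (run 1 a * s)%g.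
Proof.
elim: a s => [|e a IH] s /=; first by rewrite mul1g.
by rewrite IH [run (swap _ _ 1%g) _]IH /swap mulg1 mulgA.
Qed.

(* The tokens that arrive at the centre, where [om t] is the weight of the
   token t; by [cost_from_arrivals] their total weight determines the cost. *)
Fixpoint arrivals (R : realFieldType) (V : finType) (om : V -> R) (u : V)
    (s : {perm V}) (ls : seq V) : R :=
  if ls is l :: ls' then om (s l) + arrivals om u (swap u l s) ls' else 0.

Lemma arrivals_cat (R : realFieldType) (V : finType) (om : V -> R) (u : V)
    (s : {perm V}) (a b : seq V) :
  arrivals om u s (a ++ b) =
  arrivals om u s a + arrivals om u (run s (centre_swaps u a)) b.
Proof.
by elim: a s => [|l a IH] s /=; rewrite ?add0r // IH addrA.
Qed.

Section Instance.

Variables (R : realFieldType) (V C : finType) (I : instance R V C).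
Hypothesis starI : star_instance I.

Local Notation u := (centre I).
Local Notation om v := (weight I (tcol I v)).

Lemma adjE x y : adj I x y = (x != y) && ((x == u) || (y == u)).
Proof. by case: starI => st _ _; apply: star_adjE. Qed.

Lemma leafE v : leaf (adj I) v = (v != u).
Proof. by case: starI => st _ _; apply: star_leafE. Qed.

Lemma om_gt0 v : 0 < om v.
Proof. by case: starI => _ _; apply. Qed.

(** The token at the centre before a swap is the one that arrived in the previous swap, so each
    arrival is paid twice, on the way in and on the way out. Only the ends differ: the first
    departure has no arrival, the last arrival no departure. *)
Lemma cost_from_arrivals (s : {perm V}) (ls : seq V) :
  cost_from I s (centre_swaps u ls) =
  2 * arrivals (fun v => om v) u s ls + om (s u)
    - om (run s (centre_swaps u ls) u).
Proof.
elim: ls s => [|l ls IH] s /=; first by ring.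
by rewrite IH /swap permM tpermL; ring.
Qed.

Lemma swap_sequence_centre (ls : seq V) :
  swap_sequence I (centre_swaps u ls) = (u \notin ls).
Proof.
rewrite /swap_sequence all_map; elim: ls => //= l ls ->.
by rewrite inE negb_or adjE eqxx andbT.
Qed.

Lemma centre_swaps_of (sigma : seq (V * V)) : swap_sequence I sigma ->
  exists ls : seq V, [/\ u \notin ls,
    forall s, run s sigma = run s (centre_swaps u ls) &
    forall s, cost_from I s sigma = cost_from I s (centre_swaps u ls)].
Proof.
elim: sigma => [|[x y] sigma IH] /=; first by exists [::].
move=> /andP[]; rewrite adjE /= => /andP[xy xyu] /IH[ls [uls rls cls]].
case/orP: xyu => /eqP xyu.
  exists (y :: ls); split; first by rewrite inE negb_or -{1}xyu xy.
    by move=> s /=; rewrite rls xyu.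
  by move=> s /=; rewrite cls xyu.
exists (x :: ls); split; first by rewrite inE negb_or -{1}xyu eq_sym xy.
  by move=> s /=; rewrite rls xyu /swap tpermC.
by move=> s /=; rewrite cls xyu /swap tpermC (addrC (om _)).
Qed.

(** * A lower bound on arrivals by a potential on the set of opened labels *)

Section LowerBound.

(** [E O] is the weight of the extra arrivals still to be expected once the labels in [O] are
    opened; [nontriv] marks the labels that every solution has to open. *)
Variables (L : finType) (lab : C -> L) (nontriv : pred L) (E : {set L} -> R).

Hypothesis lab_edge : forall v, lab (vcol I v) = lab (tcol I v).
Hypothesis nontrivP : forall X, nontriv X ->
  exists v, [/\ v != u, vcol I v != tcol I v & lab (vcol I v) = X].
Hypothesis trivP : forall v, v != u -> ~~ nontriv (lab (vcol I v)) ->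
  lab (vcol I v) != lab (vcol I u) -> vcol I v = tcol I v.

(* O is the set of the labels met so far.  The first swap with a leaf of a new
   label X leaves there a foreign token, which has to come back later. *)
Hypothesis E_step : forall (O : {set L}) (x l : V), lab (vcol I u) \in O ->
  lab (vcol I x) \in O -> lab (vcol I l) \notin O ->
  E O <= E (lab (vcol I l) |: O) + om x
         + (if nontriv (lab (vcol I l)) then 0 else om l).
Hypothesis E_end : forall O : {set L}, lab (vcol I u) \in O ->
  (forall X, nontriv X -> X \in O) -> E O <= 0.

(** The debt of [s]: each of these tokens has to leave its leaf, hence to arrive at the centre, at
    least once more. *)
Definition misplaced (s : {perm V}) : R :=
  \sum_(l | (l != u) && (tcol I (s l) != vcol I l)) om (s l).

(** Only the term of [l] changes, so both sides are the same sum over the leaves other than [l]. *)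
Lemma misplaced_swap (s : {perm V}) l : l != u ->
  misplaced s - (if tcol I (s l) != vcol I l then om (s l) else 0)
  = misplaced (swap u l s) -
    (if tcol I (s u) != vcol I l then om (s u) else 0).
Proof.
move=> lu.
have D1 (s' : {perm V}) :
    misplaced s' - (if tcol I (s' l) != vcol I l then om (s' l) else 0) =
    \sum_(i | [&& i != u, i != l & tcol I (s' i) != vcol I i]) om (s' i).
  rewrite /misplaced; case: ifP => h.
    rewrite (bigD1 l) /=; last by rewrite lu h.
    rewrite addrAC subrr add0r; apply: eq_bigl => i.
    by rewrite -andbA [_ && (i != l)]andbC.
  rewrite subr0; apply: eq_bigl => i.
  by have [->|//] := eqVneq i l; rewrite h.
rewrite D1 -[in RHS](_ : swap u l s l = s u); last by rewrite permM tpermR.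
rewrite D1; apply: congr_big => // i.
  have [//|iu] := eqVneq i u; have [//|il] /= := eqVneq i l.
  by rewrite permM tpermD // eq_sym.
by move=> /and3P[iu il _]; rewrite permM tpermD // eq_sym.
Qed.

(** Induction on the swaps. At a leaf of an opened label, the arrival pays for the token removed,
    and the token dropped can only add to the debt. At a leaf of a new label the dropped token
    always adds to the debt, which makes up for the fall of [E]; if the label is trivial, the
    arriving token was not owed and pays for a further fall. *)
Lemma arrivals_ge (s : {perm V}) (O : {set L}) (ls : seq V) :
  u \notin ls -> lab (vcol I u) \in O ->
  (forall v, lab (vcol I v) \notin O -> s v = v) ->
  (forall v, tcol I (run s (centre_swaps u ls) v) = vcol I v) ->
  misplaced s + E O <= arrivals (fun v => om v) u s ls.
Proof.
elim: ls s O => [|l ls IH] s O /=.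
  move=> _ uO fixs sol.
  have -> : misplaced s = 0.
    by rewrite /misplaced big1 // => v /andP[_]; rewrite sol eqxx.
  rewrite add0r E_end // => X /nontrivP[v [vu vt <-]].
  by apply: contraNT vt => /fixs sv; rewrite -[in tcol _ _]sv sol.
rewrite inE negb_or => /andP[ul uls] uO fixs sol.
set X := lab (vcol I l); set O' := X |: O.
have uO' : lab (vcol I u) \in O' by rewrite inE uO orbT.
have fixs' v : lab (vcol I v) \notin O' -> swap u l s v = v.
  rewrite inE negb_or inE => /andP[vX vO].
  rewrite permM tpermD ?fixs //; first by apply: contraNneq vO => <-.
  by apply: contraNneq vX => <-.
have := IH _ O' uls uO' fixs' sol.
have := misplaced_swap s (ltac:(by rewrite eq_sym) : l != u).
have o1 := om_gt0 (s l).
have o2 := om_gt0 (s u).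
have [XO|XO] := boolP (X \in O).
  have -> : O' = O by apply/setUidPr; rewrite sub1set.
  case: ifP; case: ifP; lra.
(* Were the centre token [s u] from an unopened label, [s] would fix it, and injectivity would give
   [s u = u], whose label is open. *)
have suO : lab (vcol I (s u)) \in O.
  apply/negPn/negP => suO; have := suO; have /perm_inj su := fixs _ suO.
  by rewrite su uO.
have -> : tcol I (s u) != vcol I l.
  by apply: contraNneq XO => tv; rewrite /X -tv -lab_edge.
have sl : s l = l by apply: fixs.
have := E_step uO suO XO; rewrite sl -/X -/O' in o1 *; rewrite /=.
have [nX|tX] := boolP (nontriv X); first by case: ifP; lra.
rewrite -[tcol I l]trivP ?eqxx /=; first lra.
- by rewrite eq_sym.
- exact: tX.
- by apply: contraNneq XO => XE; rewrite /X XE.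
Qed.

End LowerBound.
End Instance.

(** * Eulerian circuits *)

Section Euler.

Variables (V C : eqType) (src tgt : V -> C).

Definition follows : rel V := fun v w => tgt v == src w.

Definition balanced (s : seq V) : Prop :=
  forall c, count (fun v => src v == c) s = count (fun v => tgt v == c) s.

(** Each junction of the trail is the target of one edge and the source of the next, so the two
    counts can differ only by the ends. *)
Lemma trail_count x p c : path follows x p ->
  (count (fun v => src v == c) (x :: p) + (tgt (last x p) == c)
   = count (fun v => tgt v == c) (x :: p) + (src x == c))%N.
Proof.
elim: p x => [|y p IH] x /=; first by lia.
case/andP=> /eqP xy /IH /=; rewrite xy; lia.
Qed.

Lemma balanced_perm s s' : perm_eq s s' -> balanced s -> balanced s'.
Proof. by move=> /seq.permP ps bs c; rewrite -!ps. Qed.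

Lemma balanced_cycle s : path.cycle follows s -> balanced s.
Proof.
case: s => [|x p] //=; rewrite rcons_path => /andP[tp /eqP cl] c.
by have := trail_count c tp; rewrite cl /=; lia.
Qed.

Lemma balanced_catr s s' : balanced s -> balanced (s ++ s') -> balanced s'.
Proof. by move=> bs bss c; have := bss c; have := bs c; rewrite !count_cat; lia. Qed.

Fixpoint extract (c : C) (rest : seq V) : option (V * seq V) :=
  if rest is w :: rest' then
    if c == src w then Some (w, rest')
    else if extract c rest' is Some (w', r) then Some (w', w :: r) else None
  else None.

Lemma extractP c rest : match extract c rest with
  | Some (w, r) => src w = c /\ perm_eq (w :: r) rest
  | None => forall w, w \in rest -> src w != c end.
Proof.
elim: rest => //= w rest; case: eqP => [-> //|/eqP cw] IH.
case: (extract c rest) IH => [[w' r]|].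
  move=> [? /seq.permP pr]; split=> //.
  by apply/seq.permP => a; have := pr a; rewrite /=; lia.
by move=> IH w'; rewrite inE => /predU1P[->|/IH //]; rewrite eq_sym.
Qed.

Lemma size_extract c rest w r : extract c rest = Some (w, r) ->
  size rest = (size r).+1.
Proof. by have := extractP c rest => + E; rewrite E => -[_ /perm_size <-]. Qed.

(* Hierholzer's algorithm: [stack] is a trail in reverse order, extended at its
   head while possible; an edge that cannot be extended moves to [out]. *)
Fixpoint hierholzer (n : nat) (stack out rest : seq V) : seq V * seq V :=
  if n is n'.+1 then
    if stack is v :: stack' then
      if extract (tgt v) rest is Some (w, r)
      then hierholzer n' (w :: stack) out r
      else hierholzer n' stack' (v :: out) rest
    else (out, rest)
  else (out, rest).

(** The fuel exceeds twice the size of [rest] plus the size of [stack], which drops by one in either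
    move. The edge [b] stays at the bottom of the stack, so it is the last to reach [out] and heads
    the circuit; meanwhile [out] is a trail that ends at the source of [b], and no edge of [rest]
    can continue an edge of [out]. *)
Lemma hierholzerP n b stack out rest :
  ((size rest).*2 + size stack < n)%N ->
  balanced (stack ++ out ++ rest) ->
  path (fun v w => follows w v) (head b stack) (behead stack) ->
  (if stack is v :: s then last v s = b else out != [::] /\ head b out = b) ->
  (if out is v :: o then path follows v o /\ tgt (last v o) = src b else True) ->
  (forall v w, v \in out -> w \in rest -> tgt v != src w) ->
  let: (circ, rest') := hierholzer n stack out rest in
  [/\ perm_eq (circ ++ rest') (stack ++ out ++ rest),
      circ != [::] /\ head b circ = b,
      path.cycle follows circ
    & forall v w, v \in circ -> w \in rest' -> tgt v != src w].
Proof.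
elim: n stack out rest => [|n IH] stack out rest; first by lia.
case: stack => [|v stack] /=.
  move=> _ _ _; case: out => [[]//|x o] [_ /= ->] [to co] sep; split=> //=.
  by rewrite rcons_path to /= /follows co.
move=> sz bal ts lb to sep.
have := extractP (tgt v) rest; case E : (extract _ _) => [[w r]|].
  have sr := size_extract E.
  case=> sw pr; set st := w :: v :: stack.
  have pe : perm_eq (st ++ out ++ r) (v :: stack ++ out ++ rest).
    apply/seq.permP => a; move/seq.permP/(_ a): pr => /=; rewrite !count_cat /=; lia.
  have := IH st out r; case: hierholzer => circ rest' H.
  have [] // := H.
  - by rewrite /st /=; move: sz; rewrite sr /=; lia.
  - by apply: balanced_perm bal; rewrite perm_sym.
  - by rewrite /st /= ts andbT /follows sw.
  - move=> a w' ao w'r; apply: sep => //.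
    by rewrite -(perm_mem pr) inE w'r orbT.
  by move=> pc hc cc sc; split=> //; apply: perm_trans pc pe.
move=> nor.
have cnt0 : count (fun w => src w == tgt v) rest = 0%N.
  by apply/eqP; rewrite -leqn0 leqNgt -has_count; apply/hasP => -[w /nor /negPf ->].
have tsc : (count (fun w => src w == tgt v) (v :: stack) + 1 =
            count (fun w => tgt w == tgt v) (v :: stack) + (src b == tgt v))%N.
  have : path follows b (rev (belast v stack)) by rewrite -lb rev_path.
  have rE : b :: rev (belast v stack) = rev (v :: stack).
    by rewrite (lastI v) lb rev_rcons.
  move/(trail_count (tgt v)); rewrite rE !count_rev.
  suff -> : last b (rev (belast v stack)) = v by rewrite eqxx.
  rewrite -[LHS]/(last b (b :: rev (belast v stack))) rE rev_cons last_rcons //.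
(* No edge of [rest] leaves [tgt v]. Balance and the counts of the two trails then force [v] to fit
   in front of [out], or to close up with [b] when [out] is empty. *)
have close : if out is x :: _ then tgt v = src x else tgt v = src b.
  have := bal (tgt v); rewrite -cat_cons !count_cat cnt0.
  case: out to {sep bal} => [_|x o [to lo]].
    rewrite [count _ [::]]/= [count _ [::]]/=.
    by move: tsc; case: eqP => [->//|_]; lia.
  have := trail_count (tgt v) to; rewrite lo.
  by move: tsc; case: (src x =P tgt v) => [->//|_]; lia.
have pe : perm_eq (stack ++ (v :: out) ++ rest) (v :: stack ++ out ++ rest).
  by apply/seq.permP => a; rewrite /= !count_cat /= !count_cat; lia.
have := IH stack (v :: out) rest; case: hierholzer => circ rest' H.
have [] // := H.
- by move: sz => /=; lia.
- by apply: balanced_perm bal; rewrite perm_sym.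
- by case: (stack) ts => //= y s /andP[].
- by move: lb; case: (stack) => //=.
- split; last by case: (out) to close => /= [|x o [_ ->]].
  by case: (out) to close => //= x o [-> _] /eqP; rewrite andbT.
- move=> a w; rewrite inE => /predU1P[->|]; last exact: sep.
  by move=> /nor; rewrite eq_sym.
by move=> pc hc cc sc; split=> //; apply: perm_trans pc pe.
Qed.

Definition euler_from (b : V) (rest : seq V) : seq V * seq V :=
  hierholzer (size rest).*2.+2 [:: b] [::] rest.

(** The search ends when no remaining edge leaves a target on the circuit, and on a closed circuit
    every source is also a target. This is what makes the circuit exhaust a component. *)
Lemma euler_fromP b rest : balanced (b :: rest) ->
  let: (circ, rest') := euler_from b rest in
  [/\ perm_eq (circ ++ rest') (b :: rest), circ != [::] /\ head b circ = b,
      path.cycle follows circ, balanced rest'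
    & allrel (fun v w => src v != src w) circ rest'].
Proof.
move=> bal; have := @hierholzerP (size rest).*2.+2 b [:: b] [::] rest.
rewrite /euler_from; case: hierholzer => circ rest' H.
have [] // := H; first by rewrite /= addn1.
move=> pc hc cc sc; split=> //.
  apply: (balanced_catr (balanced_cycle cc)).
  by apply: balanced_perm bal; rewrite perm_sym.
apply/allrelP => v w vc wr.
have -> : src v = tgt (prev circ v) by apply/esym/eqP/(prev_cycle cc).
by apply: sc => //; rewrite mem_prev.
Qed.

Fixpoint circuits (n : nat) (rest : seq V) : seq (seq V) :=
  if n is n'.+1 then
    if rest is b :: rest' then
      (euler_from b rest').1 :: circuits n' (euler_from b rest').2
    else [::]
  else [::].

Lemma circuitsP n rest : (size rest <= n)%N -> balanced rest ->
  [/\ perm_eq (flatten (circuits n rest)) rest,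
      all (fun K => K != [::]) (circuits n rest),
      all (path.cycle follows) (circuits n rest)
    & pairwise (allrel (fun v w => src v != src w)) (circuits n rest)].
Proof.
elim: n rest => [|n IH] [|b rest] //= sz bal.
have := euler_fromP bal; case: euler_from => circ rest' /= [pc [nc _] cc br sc].
have sr : (size rest' <= n)%N.
  by move/perm_size: pc nc; rewrite size_cat /=; case: (circ) => //= ? ?; lia.
have [pf nn cy dj] := IH _ sr br.
split; rewrite ?nc ?cc //=.
  by rewrite -(permPr pc) perm_cat2l.
rewrite dj andbT; apply/allP => K KL.
apply/allrelP => v w vc wK; move/allrelP: sc; apply=> //.
by rewrite -(perm_mem pf); apply/flattenP; exists K.
Qed.

End Euler.

(** * Solving circuits one inside the other *)

Lemma prev_notin (T : eqType) (s : seq T) (x : T) : x \notin s -> prev s x = x.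
Proof. by move=> xs; rewrite prev_nth (negPf xs). Qed.

Lemma prev_at_base (T : eqType) (x y0 y1 y : T) p : x != y0 -> x != y1 ->
  prev_at x y0 y p = prev_at x y1 y p.
Proof.
move=> /negPf x0 /negPf x1.
by elim: p y => [|z p IH] y /=; rewrite ?x0 ?x1 ?IH.
Qed.

Lemma prev_at_last (T : eqType) (y0 y : T) p : y0 \notin p ->
  prev_at y0 y0 y p = last y p.
Proof.
elim: p y => [|z p IH] y /=; first by rewrite eqxx.
by rewrite inE negb_or => /andP[/negPf -> /IH ->].
Qed.

Section CentreSwaps.

Variables (R : realFieldType) (V : finType) (om : V -> R) (u : V).

Local Notation P ls := (run 1%g (centre_swaps u ls)).

Lemma centre_run_cat a b : P (a ++ b) = (P b * P a)%g.
Proof. by rewrite /centre_swaps map_cat run_cat run_mul. Qed.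

(** Each swap drops the token picked up at the preceding leaf, so all tokens move one step along the
    cycle [u :: ls]. *)
Lemma centre_run_trail (ls : seq V) v : uniq (u :: ls) ->
  P ls v = prev (u :: ls) v.
Proof.
elim: ls => [|l ls IH] /=.
  by rewrite perm1; case: eqP.
rewrite inE negb_or => /andP[/andP[ul uls] /andP[lls uq]].
rewrite run_mul permM /swap mulg1 IH /=; last by rewrite uls uq.
case: ifPn => [/eqP ->|vl].
  rewrite -[prev_at _ _ _ _]/(prev (u :: ls) l) prev_notin ?tpermR //.
  by rewrite inE negb_or eq_sym ul lls.
case: ls uls lls {IH uq} => [_ _|k ls] /=.
  case: eqP => [_|/eqP vu]; first by rewrite tpermL.
  by rewrite tpermD // eq_sym.
case: (v =P k) => _; first by rewrite tpermL.
move=> uk lk; rewrite tpermD //.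
  elim: ls k uk lk => [|k' ls IH] k /=.
    rewrite !inE; case: (eqVneq v u) => // vu _ _; by rewrite eq_sym.
  rewrite inE negb_or => /andP[uk uk'].
  rewrite inE negb_or => /andP[lk lk'].
  by case: (v =P k') => // _; apply: IH.
elim: ls k uk lk => [|k' ls IH] k /=.
  rewrite !inE; case: (eqVneq v u) => // vu _ _; by rewrite eq_sym.
rewrite inE negb_or => /andP[uk uk'].
rewrite inE negb_or => /andP[lk lk'].
by case: (v =P k') => // _; apply: IH.
Qed.

(** The first visit to [h] parks the centre token there and the second fetches it back; the net
    effect is a rotation of a circuit that avoids [u]. *)
Lemma centre_run_excursion (h : V) (K : seq V) v : uniq (u :: h :: K) ->
  P (rcons (h :: K) h) v = prev (h :: K) v.
Proof.
move=> uq; case/andP: (uq); rewrite inE negb_or => /andP[uh uK] /andP[hK _].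
rewrite -cats1 centre_run_cat permM centre_run_trail // /= /swap mulg1.
case: tpermP => [->|->|/eqP vu /eqP vh].
- by rewrite eqxx -[RHS]/(prev (h :: K) u) prev_notin // inE negb_or uh.
- by rewrite (negPf uh) !prev_at_last.
- by rewrite (negPf vh); apply: prev_at_base.
Qed.

Lemma centre_run_commute (sg : {perm V}) (b : seq V) :
  sg u = u -> {in b, forall l, sg l = l} -> (P b * sg = sg * P b)%g.
Proof.
move=> su; elim: b => [|l b IH] sb /=; first by rewrite mul1g mulg1.
rewrite run_mul /swap mulg1 -mulgA.
have -> : (tperm u l * sg = sg * tperm u l)%g.
  by rewrite conjgC tpermJ su sb // mem_head.
rewrite !mulgA IH // => x xb; apply: sb; by rewrite inE xb orbT.
Qed.

(** [P M] fixes [u] and the leaves visited afterwards, so it commutes with the rest of the walk and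
    acts as though [M] came last. *)
Lemma centre_run_insert a M b : P M u = u -> {in b, forall l, P M l = l} ->
  P (a ++ M ++ b) = (P M * P (a ++ b))%g.
Proof.
by move=> Mu Mb; rewrite !centre_run_cat !mulgA centre_run_commute.
Qed.

Lemma arrivals_trail (s : {perm V}) a : uniq (u :: a) ->
  arrivals om u s a = \sum_(l <- a) om (s l).
Proof.
elim: a s => [|l a IH] s /=; first by rewrite big_nil.
rewrite inE negb_or => /andP[/andP[ul ua] /andP[la uq]].
rewrite big_cons IH /= ?ua //; congr (_ + _); apply: eq_big_seq => x xa.
rewrite permM tpermD //; first by apply: contraNneq ua => ->.
by apply: contraNneq la => ->.
Qed.

Lemma run_trail_out (s : {perm V}) a v : uniq (u :: a) -> v \notin u :: a ->
  run s (centre_swaps u a) v = s v.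
Proof. by move=> uq va; rewrite run_mul permM centre_run_trail // prev_notin. Qed.

Lemma run_trail_centre (s : {perm V}) a : uniq (u :: a) ->
  run s (centre_swaps u a) u = s (last u a).
Proof.
move=> uq; rewrite run_mul permM centre_run_trail //=; congr (s _).
by apply: prev_at_last; case/andP: uq.
Qed.

(** The visits in [a] and [b] meet the same tokens with or without [M], while [M] starts with the
    token of [last u a] waiting at the centre. *)
Lemma arrivals_insert (s : {perm V}) a M b : uniq (u :: a ++ b) ->
  P M u = u -> {in a ++ b, forall l, P M l = l} ->
  arrivals om u s (a ++ M ++ b) =
  \sum_(l <- a ++ b) om (s l) + arrivals om u (run s (centre_swaps u a)) M.
Proof.
rewrite /= mem_cat negb_or cat_uniq => /andP[/andP[ua ub] /and3P[qa ab qb]] Mu MK.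
have uqa : uniq (u :: a) by rewrite /= ua.
have uqb : uniq (u :: b) by rewrite /= ub.
rewrite !arrivals_cat big_cat /= arrivals_trail //.
rewrite (@arrivals_trail _ b) // addrAC addrA; congr (_ + _ + _).
apply: eq_big_seq => l lb; rewrite run_mul permM MK ?mem_cat ?lb ?orbT //.
rewrite run_trail_out // inE negb_or.
rewrite (contraNneq _ ub) /=; last by move=> <-.
by apply: contra ab => la; apply/hasP; exists l.
Qed.

(* A circuit split at its token of least weight, which is the one that stays at
   the centre while other circuits are solved. *)
Definition split_seq := (seq V * V * seq V)%type.
Definition glue (K : split_seq) : seq V := K.1.1 ++ K.1.2 :: K.2.
Definition insert_at (K : split_seq) (M : seq V) : seq V :=
  K.1.1 ++ K.1.2 :: M ++ K.2.
Definition excursion (K : split_seq) (M : seq V) : seq V :=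
  rcons (insert_at K M) (head K.1.2 (insert_at K M)).
Definition excursions (Ks : seq split_seq) : seq V :=
  flatten [seq excursion K [::] | K <- Ks].

(** For disjoint circuits this is the placement to be reached, the inverse of the assignment that
    sends each token to the next vertex of its circuit. *)
Definition prevs (Ks : seq (seq V)) (v : V) : V :=
  foldr (fun K => prev K) v Ks.

Lemma prevs_notin Ks v : v \notin flatten Ks -> prevs Ks v = v.
Proof.
elim: Ks => //= K Ks IH; rewrite mem_cat negb_or => /andP[vK /IH ->].
exact: prev_notin.
Qed.

Lemma prevs_in Ks K v : uniq (flatten Ks) -> K \in Ks -> v \in K ->
  prevs Ks v = prev K v.
Proof.
elim: Ks => //= K' Ks IH; rewrite cat_uniq inE => /and3P[_ dj uq].
case/predU1P=> [-> vK|KKs vK].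
  rewrite prevs_notin //; apply: contra dj => vKs; by apply/hasP; exists v.
rewrite IH // prev_notin //; apply: contra dj => vK'; apply/hasP.
by exists (prev K v) => //; apply/flattenP; exists K => //; rewrite mem_prev.
Qed.


Lemma glue_cons K : exists h k, glue K = h :: k.
Proof. by case: K => [[[|a A] x] B]; do 2!eexists. Qed.

Lemma head_insert_at K M : head K.1.2 (insert_at K M) = head K.1.2 (glue K).
Proof. by case: K => [[[|a A] x] B]. Qed.

Lemma excursion_eq K M : excursion K M =
  (rcons K.1.1 K.1.2 ++ M ++ K.2) ++ [:: head K.1.2 (glue K)].
Proof.
by rewrite /excursion head_insert_at -cats1 /insert_at cat_rcons.
Qed.

Lemma glue_eq K : rcons K.1.1 K.1.2 ++ K.2 = glue K.
Proof. by rewrite cat_rcons. Qed.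

Lemma mem_insert_at K M : insert_at K M =i glue K ++ M.
Proof.
by move=> v; rewrite /insert_at /glue !(mem_cat, inE) -!orbA (orbC (_ \in M)).
Qed.

Lemma mem_excursion K M : excursion K M =i glue K ++ M.
Proof.
move=> v; rewrite /excursion mem_rcons inE mem_insert_at.
case: eqP => // ->; rewrite head_insert_at mem_cat.
by case: K => [[[|a A] x] B]; rewrite /= inE eqxx.
Qed.

Lemma excursions_cons K Ks :
  excursions (K :: Ks) = excursion K [::] ++ excursions Ks.
Proof. by []. Qed.

Lemma mem_excursions Ks : excursions Ks =i flatten (map glue Ks).
Proof.
move=> v; elim: Ks => //= K Ks IH.
by rewrite excursions_cons 2!mem_cat mem_excursion cats0 IH.
Qed.

Lemma centre_run_fixed K M : P M u = u ->
  {in glue K, forall l, P M l = l} ->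
  uniq (u :: glue K) -> forall v, P (excursion K M) v = prev (glue K) (P M v).
Proof.
move=> Mu MK uq v.
have E : P (excursion K M) = (P M * P (rcons (glue K) (head K.1.2 (glue K))))%g.
  rewrite excursion_eq -!catA centre_run_insert //.
    by rewrite catA glue_eq cats1.
  move=> l; rewrite mem_cat inE => lK; apply: MK; case/orP: lK => [lK|/eqP ->].
    by rewrite /glue mem_cat inE lK !orbT.
  by case: (K) => [[[|a A] x] B]; rewrite /= inE eqxx.
rewrite E permM; have [h [k Kh]] := glue_cons K; rewrite Kh in uq *.
by rewrite -centre_run_excursion.
Qed.

(** The extra [om (s u)] is the return of the parked centre token. When [M] starts, the token of the
    split vertex [K.1.2] waits at the centre. *)
Lemma arrivals_excursion (s : {perm V}) K M : P M u = u ->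
  {in glue K, forall l, P M l = l} -> uniq (u :: glue K) ->
  arrivals om u s (excursion K M) = \sum_(l <- glue K) om (s l) + om (s u)
    + arrivals om u (run s (centre_swaps u (rcons K.1.1 K.1.2))) M.
Proof.
move=> Mu MK uq; rewrite excursion_eq arrivals_cat.
rewrite arrivals_insert ?glue_eq // addrAC; congr (_ + _ + _).
rewrite /= addr0 run_mul centre_run_insert ?glue_eq //; last first.
  by move=> l lK; apply: MK; rewrite /glue mem_cat inE lK !orbT.
rewrite !permM MK; last first.
  by case: (K) => [[[|a A] x] B]; rewrite /= inE eqxx.
rewrite centre_run_trail //; congr (om (s _)).
by have [h [k ->]] := glue_cons K; rewrite /= eqxx.
Qed.

Lemma centre_run_excursions Ks : uniq (u :: flatten (map glue Ks)) ->
  forall v, P (excursions Ks) v = prevs (map glue Ks) v.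
Proof.
elim: Ks => [_ v|K Ks IH] /=; first by rewrite perm1.
rewrite mem_cat negb_or cat_uniq => /andP[/andP[uK uKs] /and3P[qK _ qKs]] v.
rewrite excursions_cons centre_run_cat permM IH /= ?uKs // centre_run_fixed ?perm1 //=.
- by move=> l _; rewrite perm1.
- by rewrite uK.
Qed.

Lemma arrivals_excursions (s : {perm V}) Ks :
  uniq (u :: flatten (map glue Ks)) ->
  arrivals om u s (excursions Ks) =
  \sum_(l <- flatten (map glue Ks)) om (s l) + om (s u) *+ size Ks.
Proof.
elim: Ks s => [|K Ks IH] s; first by rewrite /= big_nil add0r.
rewrite /= mem_cat negb_or cat_uniq => /andP[/andP[uK uKs] /and3P[qK dj qKs]].
rewrite excursions_cons arrivals_cat arrivals_excursion ?perm1 //=; last 2 first.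
- by move=> l _; rewrite perm1.
- by rewrite uK.
rewrite IH /= ?uKs // [in RHS]big_cat /= addr0.
have st v : run s (centre_swaps u (excursion K [::])) v = s (prev (glue K) v).
  rewrite run_mul permM centre_run_fixed ?perm1 //=; last by rewrite uK.
  by move=> l _; rewrite perm1.
rewrite st prev_notin // mulrS.
have -> : \sum_(l <- flatten (map glue Ks))
    om (run s (centre_swaps u (excursion K [::])) l) =
  \sum_(l <- flatten (map glue Ks)) om (s l).
  apply: eq_big_seq => l lKs; rewrite st prev_notin //.
  by apply: contra dj => lK; apply/hasP; exists l.
by ring.
Qed.

(** The centre token is parked once, in [K], while the split token of [K] is parked in each circuit
    of [Ks]. *)
Lemma arrivals_nested (s : {perm V}) K Ks :
  uniq (u :: glue K ++ flatten (map glue Ks)) ->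
  arrivals om u s (excursion K (excursions Ks)) =
  \sum_(l <- glue K ++ flatten (map glue Ks)) om (s l) + om (s u)
    + om (s K.1.2) *+ size Ks.
Proof.
rewrite /= mem_cat negb_or cat_uniq => /andP[/andP[uK uKs] /and3P[qK dj qKs]].
have qa : uniq (u :: rcons K.1.1 K.1.2).
  move: uK qK; rewrite -glue_eq mem_cat negb_or cat_uniq /=.
  by move=> /andP[-> _] /and3P[].
have MK : {in glue K, forall l, P (excursions Ks) l = l}.
  move=> l lK; rewrite centre_run_excursions ?prevs_notin //= ?uKs //.
  by apply: contra dj => lKs; apply/hasP; exists l.
rewrite arrivals_excursion //; last 2 first.
- by rewrite centre_run_excursions ?prevs_notin //= uKs.
- by rewrite /= uK.
rewrite arrivals_excursions /= ?uKs // run_trail_centre // last_rcons.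
rewrite [in RHS]big_cat /=.
have -> : \sum_(l <- flatten (map glue Ks))
    om (run s (centre_swaps u (rcons K.1.1 K.1.2)) l) =
  \sum_(l <- flatten (map glue Ks)) om (s l).
  apply: eq_big_seq => l lKs; rewrite run_trail_out // inE negb_or.
  rewrite (contraNneq _ uKs) /=; last by move=> <-.
  apply: contra dj => la; apply/hasP; exists l => //.
  by rewrite -glue_eq mem_cat la.
by ring.
Qed.

Lemma centre_run_nested K Ks :
  uniq (u :: glue K ++ flatten (map glue Ks)) ->
  forall v, P (excursion K (excursions Ks)) v =
            prevs (glue K :: map glue Ks) v.
Proof.
rewrite /= mem_cat negb_or cat_uniq => /andP[/andP[uK uKs] /and3P[qK dj qKs]] v.
have Pe : forall w, P (excursions Ks) w = prevs (map glue Ks) w.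
  by apply: centre_run_excursions; rewrite /= uKs.
rewrite centre_run_fixed ?Pe //=; first by rewrite prevs_notin.
  move=> l lK; rewrite Pe prevs_notin //.
  by apply: contra dj => lKs; apply/hasP; exists l.
by rewrite uK.
Qed.

End CentreSwaps.

(** * Systems of circuits *)

Fixpoint split_min (R : realFieldType) (T : Type) (key : T -> R) (x : T)
    (s : seq T) : seq T * T * seq T :=
  if s is y :: s' then
    let K := split_min key y s' in
    if key x <= key K.1.2 then ([::], x, s) else (x :: K.1.1, K.1.2, K.2)
  else ([::], x, [::]).

Lemma split_min_cat (R : realFieldType) (T : Type) (key : T -> R) x s :
  let K := split_min key x s in K.1.1 ++ K.1.2 :: K.2 = x :: s.
Proof.
elim: s x => //= y s IH x; case: ifP => //= _.
by rewrite IH.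
Qed.

Lemma split_min_le (R : realFieldType) (T : eqType) (key : T -> R) x s :
  {in x :: s, forall y, key (split_min key x s).1.2 <= key y}.
Proof.
elim: s x => [|y s IH] x z /=; first by rewrite inE => /eqP ->.
rewrite inE; case: ifPn => /= [le|]; last rewrite -ltNge => lt.
  by case/predU1P=> [->//|/IH]; apply: le_trans.
by case/predU1P=> [->|/IH //]; apply: ltW.
Qed.

Section Plan.

Variables (R : realFieldType) (V C : finType) (I : instance R V C).
Hypothesis starI : star_instance I.

Local Notation u := (centre I).
Local Notation om := (fun v => weight I (tcol I v)).
Local Notation P ls := (run 1%g (centre_swaps u ls)).

(** Disjoint colours and full coverage make each circuit an Eulerian circuit of a whole component of
    G'. The circuits behind a given [T_A] and those found by the algorithm both form such a system,
    so optimality is proved once for the two. *)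
Record circuit_system (K0 : seq V) (Ks : seq (seq V)) : Prop := CircuitSystem {
  cs_uniq : uniq (flatten (K0 :: Ks));
  cs_mem : forall v, (v \in flatten (K0 :: Ks)) = ~~ leaf_loop I v;
  cs_centre : K0 = u :: behead K0;
  cs_nonempty : all (fun K => K != [::]) Ks;
  cs_cycle : all (path.cycle (follows (vcol I) (tcol I))) (K0 :: Ks);
  cs_disjoint : pairwise (allrel (fun v w => vcol I v != vcol I w)) (K0 :: Ks)
}.

Section System.

Variables (K0 : seq V) (Ks : seq (seq V)).
Hypothesis sysK : circuit_system K0 Ks.

(** Index 0 is the component of the centre and 1 to [n] are the other circuits. A colour on no
    circuit gets the default of [find], the number [n.+1] of circuits; its only edges are leaf
    loops. *)
Definition circuit_index (c : C) : nat :=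
  find (has (fun v => vcol I v == c)) (K0 :: Ks).

Local Notation n := (size Ks).
Local Notation circ i := (nth [::] (K0 :: Ks) i).

Lemma circuit_index_le c : (circuit_index c < n.+2)%N.
Proof. by rewrite ltnS; apply: find_size. Qed.

Lemma circuit_index_vcol i v : (i < n.+1)%N -> v \in circ i ->
  circuit_index (vcol I v) = i.
Proof.
move=> lin vi; rewrite /circuit_index; set a := has _.
have ai : a (circ i) by apply/hasP; exists v.
have fi : (find a (K0 :: Ks) <= i)%N.
  by rewrite leqNgt; apply/negP => /(before_find [::]); rewrite ai.
apply/eqP; rewrite eqn_leq fi leqNgt /=; apply/negP => lt.
have /(nth_find [::])/hasP[w wf /eqP wv] : has a (K0 :: Ks).
  by rewrite has_find (leq_ltn_trans fi).
have /pairwiseP - /(_ [::] _ i) := cs_disjoint sysK.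
move=> /(_ _ (leq_ltn_trans fi lin) lin lt) /allrelP /(_ w v wf vi).
by rewrite wv eqxx.
Qed.

Lemma circ_cycle i : (i < n.+1)%N ->
  path.cycle (follows (vcol I) (tcol I)) (circ i).
Proof. by move=> lin; apply: (allP (cs_cycle sysK)); rewrite mem_nth. Qed.

Lemma circuit_index_tcol i v : (i < n.+1)%N -> v \in circ i ->
  circuit_index (tcol I v) = i.
Proof.
move=> lin vi; have /eqP -> := next_cycle (circ_cycle lin) vi.
by apply: circuit_index_vcol; rewrite ?mem_next.
Qed.

Lemma circuit_of v : ~~ leaf_loop I v -> exists2 i, (i < n.+1)%N & v \in circ i.
Proof.
rewrite -(cs_mem sysK) => /flattenP[K Kin vK].
by exists (index K (K0 :: Ks)); rewrite ?index_mem // nth_index.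
Qed.

Lemma circuit_index_edge v :
  circuit_index (vcol I v) = circuit_index (tcol I v).
Proof.
have [/andP[_ /eqP ->] //|/circuit_of[i lin vi]] := boolP (leaf_loop I v).
by rewrite (circuit_index_vcol lin vi) (circuit_index_tcol lin vi).
Qed.

Lemma centre_in : u \in circ 0.
Proof. by rewrite /= (cs_centre sysK) inE eqxx. Qed.

Lemma circuit_index_centre : circuit_index (vcol I u) = 0%N.
Proof. by apply: circuit_index_vcol => //; apply: centre_in. Qed.

(** Each colour met by a circuit is also the colour of a token on it, so a leaf loop at such a
    colour is no lighter than the lightest token of the circuit. *)
Lemma circ_weight v : (circuit_index (vcol I v) < n.+1)%N ->
  exists2 y, y \in circ (circuit_index (vcol I v)) & om y = om v.
Proof.
move=> lin; have := lin; rewrite circuit_index_edge -[n.+1]/(size (K0 :: Ks)).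
rewrite -has_find => /(nth_find [::])/hasP[y].
rewrite -/(circuit_index _) -circuit_index_edge => yi /eqP yv.
exists (prev (circ (circuit_index (vcol I v))) y); first by rewrite mem_prev.
by have /eqP -> := prev_cycle (circ_cycle lin) yi; rewrite yv.
Qed.

(** * The potential of a circuit system *)

Section Bound.

(** [E0] is any number below the extra weights of the three strategies. Keeping [mu] below [m0] and
    [g] as well makes it a lower bound for all tokens. *)
Variables (E0 m0 g mu : R).
Hypothesis m0P : {in K0, forall v, m0 <= om v}.
Hypothesis gP : {in flatten Ks, forall v, g <= om v}.
Hypothesis muP : forall v, leaf_loop I v -> mu <= om v.
Hypothesis mu_ge0 : 0 <= mu.
Hypothesis mu_m0 : mu <= m0.
Hypothesis mu_g : mu <= g.
Hypothesis E0_stay : E0 <= n%:R * m0.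
Hypothesis E0_circ : (0 < n)%N -> E0 <= m0 + n.-1%:R * g.
Hypothesis E0_loop : E0 <= m0 + n.+1%:R * mu.

Local Notation lab c := (Ordinal (circuit_index_le c)).
Local Notation L := 'I_n.+2.

Definition nontrivial : pred L := fun X => (0 < X < n.+1)%N.
Definition untouched (O : {set L}) : nat := #|[set X | nontrivial X] :\: O|.
Definition touched_weight : R := Num.min m0 g.
Local Notation h := touched_weight.

(** At the start the token left behind weighs at least [m0], hence the special value. Once a colour
    on no circuit is opened, the waiting token is only known to weigh [mu]. Before that it weighs at
    least [h]; opening such a colour later costs two more arrivals, of the token left there and of
    the displaced loop token, hence the [.+2]. *)
Definition extra_bound (O : {set L}) : R :=
  if O == [set ord0] then E0 else
  if ord_max \in O then (untouched O)%:R * mu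
  else Num.min ((untouched O)%:R * h) ((untouched O).+2%:R * mu).

Lemma h_le v : (circuit_index (vcol I v) < n.+1)%N -> h <= om v.
Proof.
move=> lin; have [y yi <-] := circ_weight lin; rewrite /touched_weight.
case: (circuit_index _) lin yi => [|i] /= lin yi; first by rewrite ge_min m0P.
rewrite ge_min gP ?orbT //; apply/flattenP; exists (nth [::] Ks i) => //.
exact: mem_nth.
Qed.

Lemma mu_h : mu <= h.
Proof. by rewrite /touched_weight le_min mu_m0. Qed.

Lemma mu_le v : mu <= om v.
Proof.
have [/muP //|/circuit_of[i lin vi]] := boolP (leaf_loop I v).
apply: (le_trans mu_h); apply: h_le.
by rewrite (circuit_index_vcol lin vi).
Qed.

Lemma untouchedU1 X (O : {set L}) : X \notin O -> nontrivial X ->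
  untouched O = (untouched (X |: O)).+1.
Proof.
move=> XO nX; rewrite /untouched (cardsD1 X) !inE XO nX /= add1n; congr _.+1.
by apply: eq_card => Y; rewrite !inE negb_or andbA.
Qed.

Lemma untouchedU1_triv X (O : {set L}) : ~~ nontrivial X ->
  untouched (X |: O) = untouched O.
Proof.
move=> nX; apply: eq_card => Y; rewrite !inE negb_or.
by have [->|//] := eqVneq Y X; rewrite (negPf nX) !andbF.
Qed.

Lemma untouched_centre : untouched [set ord0] = n.
Proof.
rewrite /untouched.
have -> : [set X | nontrivial X] :\: [set ord0]
          = [set: L] :\: [set ord0; ord_max].
  apply/setP => X; rewrite !inE /nontrivial andbT negb_or -!val_eqE /=.
  by case: X => X /= ltX; lia.
rewrite cardsD setTI cards2 cardsT card_ord -val_eqE /=; lia.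
Qed.

Lemma trivial_lab (X : L) : ~~ nontrivial X -> X = ord0 \/ X = ord_max.
Proof.
case: X => X ltX; rewrite /nontrivial /= => tX.
have [X0|X0] := posnP X; first by left; apply/val_inj.
by right; apply/val_inj => /=; move: tX; rewrite X0 /= -leqNgt; lia.
Qed.

Lemma extra_bound_step (O : {set L}) (x l : V) : lab (vcol I u) \in O ->
  lab (vcol I x) \in O -> lab (vcol I l) \notin O ->
  extra_bound O <= extra_bound (lab (vcol I l) |: O) + om x
         + (if nontrivial (lab (vcol I l)) then 0 else om l).
Proof.
have -> : lab (vcol I u) = ord0 by apply/val_inj; rewrite /= circuit_index_centre.
set X := lab (vcol I l) => uO xO XO.
have mux := mu_le x; have mul := mu_le l; have muh := mu_h.
have XO0 : (X |: O == [set ord0]) = false.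
  apply/negbTE/negP => /eqP/setP/(_ X); rewrite !inE eqxx /= => /esym/eqP X0.
  by rewrite X0 uO in XO.
rewrite {2}/extra_bound XO0.
have hx : ord_max \notin O -> h <= om x.
  move=> mO; apply: h_le; rewrite ltn_neqAle -ltnS circuit_index_le andbT.
  apply: contra mO => /eqP mx.
  by rewrite (_ : ord_max = lab (vcol I x)) //; apply/val_inj.
have m0x : O = [set ord0] -> m0 <= om x.
  move=> O0; move: xO; rewrite O0 inE => /eqP/(congr1 val) /= ix.
  have [] := @circ_weight x; rewrite ix // => y yK0 <-; exact: m0P.
have hm0 : h <= m0 by rewrite /touched_weight ge_min lexx.
have hg : h <= g by rewrite /touched_weight ge_min lexx orbT.
(* If [m0 <= g] then [h] is [m0] and the first strategy gives the bound; otherwise [h] is [g] and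
   the second one does. *)
have E0h : (0 < n)%N -> E0 <= m0 + n.-1%:R * h.
  move=> n0; rewrite /touched_weight; case: (leP m0 g) => _; last exact: E0_circ.
  by move: E0_stay; case: (n) n0 => // k _ /=; rewrite -natr1; lra.
have [nX|tX] := boolP (nontrivial X).
  have -> : (ord_max \in X |: O) = (ord_max \in O).
    rewrite in_setU1; case: eqP => // mX; move: nX.
    by rewrite -mX /nontrivial /= ltnn.
  rewrite /extra_bound (untouchedU1 XO nX); set k := untouched (X |: O).
  have [O0|_] := eqVneq O [set ord0].
    have kn : n = k.+1 by rewrite -untouched_centre -O0 (untouchedU1 XO nX).
    rewrite O0 in_set1 /=.
    have := m0x O0; have := E0_loop; have := E0h; rewrite kn /= => /(_ isT).
    by rewrite -!natr1 => ? ? ?; case: (leP (k%:R * h)) => _; lra.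
  case: ifPn => [_|/hx]; first by rewrite -natr1; lra.
  rewrite -!natr1 => ?; case: (leP (k%:R * h)) => _;
    by case: (leP ((k%:R + 1) * h)) => ?; lra.
(* The label 0 is already open, so the only trivial label that can be new is the last one. *)
have mX : X = ord_max.
  by have [X0|//] := trivial_lab tX; rewrite X0 uO in XO.
rewrite (untouchedU1_triv _ tX) mX in_setU1 eqxx /= /extra_bound -mX.
have [O0|_] := eqVneq O [set ord0].
  rewrite O0 untouched_centre; have := m0x O0; have := E0_loop.
  by rewrite -natr1; lra.
by rewrite (negPf XO) -!natr1; case: (leP (_ * h)) => ?; lra.
Qed.

Lemma extra_bound_end (O : {set L}) : lab (vcol I u) \in O ->
  (forall X, nontrivial X -> X \in O) -> extra_bound O <= 0.
Proof.
move=> uO nO.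
have u0 : untouched O = 0%N.
  apply/eqP; rewrite /untouched cards_eq0 setD_eq0; apply/subsetP => X.
  by rewrite inE => /nO.
rewrite /extra_bound u0; case: eqP => [O0|_].
  have := E0_stay; rewrite -untouched_centre -O0 u0; lra.
by case: ifP => _; rewrite ?ge_min ?mul0r ?lexx.
Qed.

Lemma coloured_arrivals_ge ls : u \notin ls ->
  (forall v, tcol I (P ls v) = vcol I v) ->
  \sum_(v <- behead K0 ++ flatten Ks) om v + E0 <= arrivals om u 1%g ls.
Proof.
move=> uls sol.
have st := @arrivals_ge R V C I starI L (fun c => lab c) nontrivial extra_bound.
have := st _ _ _ extra_bound_step extra_bound_end 1%g [set ord0] ls uls _ _ sol.
have -> : misplaced I 1%g = \sum_(v <- behead K0 ++ flatten Ks) om v.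
  rewrite big_uniq /=; last first.
    by have := cs_uniq sysK; rewrite /= (cs_centre sysK) => /andP[].
  rewrite /misplaced; apply: eq_big => v; last by rewrite perm1.
  have := cs_mem sysK v; have := cs_uniq sysK.
  rewrite /= (cs_centre sysK) /= => /andP[uK _].
  rewrite inE /leaf_loop leafE // perm1 eq_sym.
  case: (eqVneq u v) => [<- _|vu /= ->]; first by rewrite (negPf uK).
  by rewrite eq_sym.
have -> : extra_bound [set ord0] = E0 by rewrite /extra_bound eqxx.
apply.
- by move=> v; apply/val_inj/circuit_index_edge.
- move=> X /andP[X0 Xn].
  have KX : circ X \in Ks by case: (nat_of_ord X) X0 Xn => // i _ lin; apply: mem_nth.
  have := allP (cs_nonempty sysK) _ KX; case E : (circ X) => [//|v K] _.
  have vX : v \in circ X by rewrite E mem_head.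
  have iv := circuit_index_vcol Xn vX.
  have vu : v != u.
    apply: contraTneq X0 => vu; rewrite -leqNgt -iv vu.
    by rewrite circuit_index_centre.
  exists v; split=> //; last exact/val_inj.
  have : ~~ leaf_loop I v.
    rewrite -(cs_mem sysK); apply/flattenP; exists (circ X) => //.
    by rewrite inE KX orbT.
  by rewrite /leaf_loop leafE // vu.
- move=> v vu; rewrite /nontrivial -val_eqE /= circuit_index_centre -lt0n => nt lab0.
  have [/andP[_ /eqP //]|/circuit_of[i lin vi]] := boolP (leaf_loop I v).
  by move: nt; rewrite lab0 (circuit_index_vcol lin vi) lin.
- by rewrite inE; apply/eqP/val_inj; rewrite /= circuit_index_centre.
- by move=> v _; rewrite perm1.
Qed.

End Bound.
End System.
End Plan.

Lemma prevs_perm (V : finType) (Ks Ks' : seq (seq V)) v : perm_eq Ks Ks' ->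
  uniq (flatten Ks) -> prevs Ks v = prevs Ks' v.
Proof.
move=> pK uq; have pf := perm_flatten pK.
have uq' : uniq (flatten Ks') by rewrite -(perm_uniq pf).
have [/flattenP[K Kin vK]|vK] := boolP (v \in flatten Ks).
  by rewrite (prevs_in uq Kin vK) (prevs_in uq' _ vK) // -(perm_mem pK).
by rewrite !prevs_notin // -(perm_mem pf).
Qed.

(** * The swap plan and its optimality *)

Section Plan.

Variables (R : realFieldType) (V C : finType) (I : instance R V C).

Local Notation u := (centre I).
Local Notation om := (fun v => weight I (tcol I v)).
Local Notation P ls := (run 1%g (centre_swaps u ls)).

Definition split_circuit (K : seq V) : split_seq V :=
  if K is x :: s then split_min om x s else ([::], u, [::]).

Definition split_weight (K : split_seq V) : R := om K.1.2.

Lemma split_circuitK K : K != [::] -> glue (split_circuit K) = K.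
Proof. by case: K => // x s _; apply: split_min_cat. Qed.

Lemma split_circuit_le K : {in K, forall v, split_weight (split_circuit K) <= om v}.
Proof. by case: K => // x s v vK; apply: (split_min_le om vK). Qed.

(** Repeated addition stands in for a multiplication by the length, which is not an operation of the
    program. *)
Definition add_each (T : Type) (m a : R) (s : seq T) : R :=
  foldr (fun _ r => m + r) a s.

Lemma add_eachE (T : Type) (m a : R) (s : seq T) :
  add_each m a s = (size s)%:R * m + a.
Proof. by elim: s => [|x s IH] /=; rewrite ?IH ?mul0r ?add0r // -natr1; ring. Qed.

(* Every circuit outside K0 costs one more arrival at the centre of the token
   that waits for it to be solved.  This token is the lightest one of K0, or
   the lightest one of another circuit, or a correctly placed leaf token. *)
Definition plan_stay (m0 : R) (Ks : seq (split_seq V)) : R * seq V :=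
  (add_each m0 (m0 - m0) Ks, excursions Ks).

Definition plan_circ (m0 : R) (Ks : seq (split_seq V)) : option (R * seq V) :=
  if Ks is K :: Ks' then
    let S := split_min split_weight K Ks' in
    Some (add_each (split_weight S.1.2) m0 (S.1.1 ++ S.2),
          excursion S.1.2 (excursions (S.1.1 ++ S.2)))
  else None.

Definition plan_loop (m0 : R) (Ks : seq (split_seq V)) (Z : seq V) :
    option (R * seq V) :=
  if Z is z :: Z' then
    let y := (split_min om z Z').1.2 in
    Some (add_each (om y) (m0 + om y) Ks,
          excursion ([::], y, [::]) (excursions Ks))
  else None.

Definition cheaper (c : R * seq V) (o : option (R * seq V)) : R * seq V :=
  if o is Some c' then if c'.1 <= c.1 then c' else c else c.

Definition plan_middle (m0 : R) (Ks : seq (split_seq V)) (Z : seq V) : R * seq V :=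
  cheaper (cheaper (plan_stay m0 Ks) (plan_circ m0 Ks)) (plan_loop m0 Ks Z).

Definition plan (K0 : split_seq V) (Ks : seq (split_seq V)) (Z : seq V) : seq V :=
  behead (insert_at K0 (plan_middle (split_weight K0) Ks Z).2).

Hypothesis starI : star_instance I.

Section System.

Variables (K0 : seq V) (Ks : seq (seq V)) (Z : seq V).
Hypothesis sysK : circuit_system I K0 Ks.
Hypothesis ZP : forall z, (z \in Z) = leaf_loop I z.

Local Notation S0 := (split_circuit K0).
Local Notation Ss := (map split_circuit Ks).
Local Notation m0 := (split_weight S0).
Local Notation best := (plan_middle m0 Ss Z).

Lemma K0_neq0 : K0 != [::].
Proof. by rewrite (cs_centre sysK). Qed.

Lemma glue_Ss : map (@glue V) Ss = Ks.
Proof.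
rewrite -map_comp -[RHS]map_id; apply/eq_in_map => K KK /=.
by apply: split_circuitK; apply: (allP (cs_nonempty sysK)).
Qed.

Lemma uniq_Ks : uniq (u :: flatten Ks).
Proof.
have := cs_uniq sysK; rewrite /= cat_uniq => /and3P[_ dj ->]; rewrite andbT.
apply: contra dj => uK; apply/hasP; exists u => //.
by rewrite (cs_centre sysK) mem_head.
Qed.

(** The block is run while [K0] is half solved, so [s] is known only outside [K0], and of the
    waiting token only the weight matters. *)
Definition valid_middle (c : R * seq V) : Prop :=
  [/\ u \notin c.2, forall v, P c.2 v = prevs Ks v
    & forall s : {perm V}, (forall v, v \notin K0 -> s v = v) ->
      om (s u) = m0 ->
      arrivals om u s c.2 = \sum_(v <- flatten Ks) om v + c.1].

Lemma Ks_notin_K0 v : v \in flatten Ks -> v \notin K0.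
Proof.
have := cs_uniq sysK; rewrite /= cat_uniq => /and3P[_ dj _] vKs.
by apply: contra dj => vK; apply/hasP; exists v.
Qed.

Lemma valid_stay : valid_middle (plan_stay m0 Ss).
Proof.
split=> /=.
- by rewrite mem_excursions glue_Ss; have := uniq_Ks => /andP[].
- by move=> v; rewrite centre_run_excursions glue_Ss // uniq_Ks.
move=> s sf su; rewrite arrivals_excursions glue_Ss ?uniq_Ks // su.
(* [m0 - m0] is the zero that a language without numerals can compute. *)
rewrite add_eachE subrr addr0 mulr_natl; congr (_ + _).
by apply: eq_big_seq => v /Ks_notin_K0/sf ->.
Qed.

Lemma valid_circ c : plan_circ m0 Ss = Some c -> valid_middle c.
Proof.
rewrite /plan_circ; case E : Ss => [//|K Ks'].
have := split_min_cat split_weight K Ks'; rewrite /= -E.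
case: split_min => [[A K'] B] /= SE [<-].
have pS : perm_eq (K' :: A ++ B) Ss.
  by rewrite -SE; apply/seq.permP => a; rewrite /= !count_cat /=; lia.
have pK : perm_eq (glue K' :: map (@glue V) (A ++ B)) Ks.
  by rewrite -glue_Ss -map_cons; apply: perm_map.
have pf : perm_eq (glue K' ++ flatten (map (@glue V) (A ++ B))) (flatten Ks).
  exact: (perm_flatten pK).
have uq : uniq (u :: glue K' ++ flatten (map (@glue V) (A ++ B))).
  by rewrite (perm_uniq (_ : perm_eq _ (u :: flatten Ks))) ?uniq_Ks // perm_cons.
split=> /=.
- rewrite mem_excursion mem_cat mem_excursions -mem_cat (perm_mem pf).
  by have := uniq_Ks => /andP[].
- move=> v; rewrite centre_run_nested //; apply: prevs_perm => //.
  by rewrite (perm_uniq pf); have := uniq_Ks => /andP[].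
move=> s sf su; rewrite arrivals_nested // su (perm_big _ pf) /=.
rewrite add_eachE -[_ *+ _]mulr_natl -addrA [m0 + _]addrC; congr (_ + _ ).
  by apply: eq_big_seq => v /Ks_notin_K0/sf ->.
rewrite sf //; apply: Ks_notin_K0; rewrite -(perm_mem pf) mem_cat.
by rewrite /glue mem_cat inE eqxx orbT.
Qed.

(** The loop [y] acts as a circuit of length one: its excursion puts its token back, which in
    between waits at the centre for the other circuits. Its own arrival is not in the sum over [Ks],
    hence the [om y] added to [m0]. *)
Lemma valid_loop c : plan_loop m0 Ss Z = Some c -> valid_middle c.
Proof.
rewrite /plan_loop; case E : Z => [//|z Z'].
have := split_min_cat om z Z'; rewrite -E.
case: split_min => [[A y] B] SE [<-].
have yl : y \notin flatten (K0 :: Ks).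
  by rewrite (cs_mem sysK) negbK -ZP -SE mem_cat inE eqxx orbT.
have [yK0 yKs] : y \notin K0 /\ y \notin flatten Ks.
  by apply/andP; rewrite -negb_or -mem_cat.
have uq : uniq (u :: glue ([::], y, [::]) ++ flatten (map (@glue V) Ss)).
  rewrite glue_Ss; have := uniq_Ks; rewrite /= inE negb_or yKs => /andP[-> ->].
  by rewrite !andbT; apply: contraNneq yK0 => <-; rewrite (cs_centre sysK) mem_head.
have [M ME] : exists M, M = excursion ([::], y, [::]) (excursions Ss) by eexists.
rewrite -ME; split; rewrite [_.2]/= ?[_.1]/= ME.
- rewrite mem_excursion mem_cat mem_excursions -mem_cat.
  by case/andP: uq.
- move=> v; rewrite centre_run_nested // glue_Ss /=.
  by case: eqP.
move=> s sf su; rewrite arrivals_nested // su glue_Ss [glue _]/= big_cons.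
rewrite (sf y) // add_eachE -[_ *+ _]mulr_natl size_map.
have -> : \sum_(v <- flatten Ks) om (s v) = \sum_(v <- flatten Ks) om v.
  by apply: eq_big_seq => v /Ks_notin_K0/sf ->.
rewrite /=; ring.
Qed.

Lemma valid_cheaper c o : valid_middle c ->
  (forall c', o = Some c' -> valid_middle c') -> valid_middle (cheaper c o).
Proof. by move=> vc; case: o => //= c' vc'; case: ifP => // _; apply: vc'. Qed.

Lemma valid_best : valid_middle best.
Proof.
apply: valid_cheaper; last exact: valid_loop.
by apply: valid_cheaper; [exact: valid_stay | exact: valid_circ].
Qed.

Lemma cheaper_le c o : (cheaper c o).1 <= c.1.
Proof. by case: o => //= c'; case: ifP. Qed.

Lemma cheaper_ge c c' : (cheaper c (Some c')).1 <= c'.1.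
Proof. by rewrite /=; case: ifPn => //; rewrite -ltNge => /ltW. Qed.

Local Notation n := (size Ks).

Lemma best_stay : best.1 <= n%:R * m0.
Proof.
apply: le_trans (cheaper_le _ _) _; apply: le_trans (cheaper_le _ _) _.
by rewrite /= add_eachE size_map subrr addr0.
Qed.

Lemma best_circ : (0 < n)%N -> exists g, [/\ 0 <= g,
  {in flatten Ks, forall v, g <= om v} & best.1 <= m0 + n.-1%:R * g].
Proof.
move=> n0; have : size Ss = n by rewrite size_map.
rewrite /plan_middle /plan_circ; case E : Ss => [|K Ks'] sS.
  by rewrite -sS in n0.
have := split_min_cat split_weight K Ks'.
have := split_min_le split_weight (x := K) (s := Ks').
set S := split_min split_weight K Ks'; rewrite -E => Sle Scat.
exists (split_weight S.1.2); split.
- by rewrite ltW // /split_weight om_gt0.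
- move=> v /flattenP[K' K'in vK'].
  by apply: le_trans (split_circuit_le vK'); apply: Sle; apply: map_f.
apply: le_trans (cheaper_le _ _) _; apply: le_trans (cheaper_ge _ _) _.
rewrite /= add_eachE addrC -sS -E -Scat !size_cat /= addnS /=.
exact: lexx.
Qed.

Lemma best_loop z : leaf_loop I z -> exists f, [/\ 0 <= f,
  forall v, leaf_loop I v -> f <= om v & best.1 <= m0 + n.+1%:R * f].
Proof.
rewrite -ZP /plan_middle /plan_loop; case E : Z => [//|z' Z'] _.
have := split_min_le om (x := z') (s := Z'); rewrite -E.
set y := (split_min _ _ _).1.2 => yle; exists (om y); split.
- by rewrite ltW // om_gt0.
- by move=> v; rewrite -ZP => /yle.
apply: le_trans (cheaper_ge _ _) _.
by rewrite /= add_eachE size_map -natr1; lra.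
Qed.

Lemma best_le_arrivals ls : u \notin ls ->
  (forall v, tcol I (P ls v) = vcol I v) ->
  \sum_(v <- behead K0 ++ flatten Ks) om v + best.1 <= arrivals om u 1%g ls.
Proof.
move=> uls sol.
have m0_ge0 : 0 <= m0 by rewrite ltW // /split_weight om_gt0.
(* Without other circuits there is no token to supply [g], and [m0] is a harmless value. *)
have [g [g0 gP gb]] : exists g, [/\ 0 <= g,
  {in flatten Ks, forall v, g <= om v} & (0 < n)%N -> best.1 <= m0 + n.-1%:R * g].
  have [n0|/best_circ[g [? ? ?]]] := posnP n; last by exists g.
  by exists m0; split=> //; rewrite (size0nil n0).
have [mu [mu0 muP mum0 mug mub]] : exists mu, [/\ 0 <= mu,
  forall v, leaf_loop I v -> mu <= om v, mu <= m0, mu <= g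
  & best.1 <= m0 + n.+1%:R * mu].
  (* [mu] may fail to be the weight of a loop: the first two strategies already cost no more than
     the third would with weight [Num.min m0 g]. *)
  have bm : best.1 <= m0 + n.+1%:R * Num.min m0 g.
    have := best_stay; case: (leP m0 g) => _; first by rewrite -natr1; lra.
    by case: (n) gb => [_|k /(_ isT)] /=; rewrite -!natr1; lra.
  have [/existsP[z /best_loop[f [f0 fP fb]]]|nz] := boolP [exists z, leaf_loop I z].
    exists (Num.min f (Num.min m0 g)); split.
    - by rewrite !le_min f0 m0_ge0.
    - by move=> v /fP; rewrite ge_min => ->.
    - by rewrite !ge_min lexx orbT.
    - by rewrite !ge_min lexx !orbT.
    - by case: (leP f).
  exists (Num.min m0 g); split=> //.
  - by rewrite !le_min g0 m0_ge0.
  - by move=> v lv; case/existsP: nz; exists v.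
  - by rewrite ge_min lexx.
  - by rewrite ge_min lexx orbT.
apply: (coloured_arrivals_ge starI sysK (m0 := m0) (g := g) (mu := mu)) => //.
- exact: split_circuit_le.
- exact: best_stay.
Qed.

Definition plan_leaves : seq V := plan S0 Ss Z.

(** [K0] begins with [u], which is not swapped with itself. If the split vertex is [u] then [a] is
    empty, otherwise [a] ends with that vertex; either way its token is at the centre when the
    middle block begins. *)
Lemma plan_decomposition : exists a b, plan_leaves = a ++ best.2 ++ b /\
  [/\ a ++ b = behead K0, uniq (u :: a ++ b) & last u a = S0.1.2].
Proof.
have [M best2] : exists M, M = best.2 by exists best.2.
have := split_circuitK K0_neq0; rewrite /plan_leaves /plan -best2.
case: S0 {best2} => [[A x] B] SE.
have uq : uniq K0 by have := cs_uniq sysK; rewrite /= cat_uniq => /andP[].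
move: SE uq; rewrite (cs_centre sysK) /glue /insert_at /=.
case: A => [|a A] /= [] => [->|_] <- uq; first by exists [::], B.
by exists (rcons A x), B; rewrite !cat_rcons last_rcons.
Qed.

Lemma plan_leavesP :
  [/\ u \notin plan_leaves, forall v, P plan_leaves v = prevs (K0 :: Ks) v
    & arrivals om u 1%g plan_leaves =
      \sum_(v <- behead K0 ++ flatten Ks) om v + best.1].
Proof.
have [a [b [-> [abK uq la]]]] := plan_decomposition.
have [uM PM arM] := valid_best.
have uab : u \notin a ++ b by case/andP: uq.
have qa : uniq (u :: a).
  by move: uq; rewrite /= mem_cat negb_or cat_uniq => /andP[/andP[-> _] /andP[]].
have Mfix v : v \in K0 -> P best.2 v = v.
  by move=> vK; rewrite PM prevs_notin //; apply: contraL vK; apply: Ks_notin_K0.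
have MK0 : {in a ++ b, forall l, P best.2 l = l}.
  by move=> l lab; apply: Mfix; rewrite (cs_centre sysK) inE -abK lab orbT.
have Mu : P best.2 u = u by apply: Mfix; rewrite (cs_centre sysK) mem_head.
split.
- move: uab; rewrite !mem_cat !negb_or => /andP[-> ->]; by rewrite uM.
- move=> v; rewrite centre_run_insert //; last first.
    by move=> l lb; apply: MK0; rewrite mem_cat lb orbT.
  by rewrite permM PM centre_run_trail // abK -(cs_centre sysK).
rewrite arrivals_insert // arM.
- rewrite abK big_cat /= addrA; congr (_ + _ + _).
  by apply: eq_bigr => v _; rewrite perm1.
- move=> v vK; rewrite run_trail_out ?perm1 //; apply: contra vK.
  rewrite (cs_centre sysK) -abK !inE mem_cat => /orP[->//|->]; by rewrite orbT.
by rewrite run_trail_centre // perm1 la.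
Qed.

(** All solutions start with the same token at the centre and end with tokens of the same colour
    there, so their costs compare as their arrivals do. *)
Lemma plan_optimal sigma : solves_coloured I sigma ->
  cost I (centre_swaps u plan_leaves) <= cost I sigma.
Proof.
move=> [sw sol]; have [ls [uls rls cls]] := centre_swaps_of starI sw.
have [_ _ arr] := plan_leavesP.
have solls v : tcol I (P ls v) = vcol I v by rewrite -rls.
have := best_le_arrivals uls solls; rewrite /cost cls !cost_from_arrivals arr.
have -> : tcol I (P ls u) = tcol I (P plan_leaves u); last by lra.
rewrite solls; have [_ -> _] := plan_leavesP.
have uK : u \in K0 by rewrite (cs_centre sysK) mem_head.
rewrite (prevs_in (cs_uniq sysK) (mem_head _ _) uK).
by have /eqP := prev_cycle (allP (cs_cycle sysK) _ (mem_head _ _)) uK.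
Qed.

Lemma plan_solves : solves_coloured I (centre_swaps u plan_leaves).
Proof.
have [uls PE _] := plan_leavesP.
split=> [|v]; first by rewrite swap_sequence_centre.
rewrite PE.
have [lv|nl] := boolP (leaf_loop I v).
  rewrite prevs_notin; last by rewrite (cs_mem sysK) negbK.
  by case/andP: lv => _ /eqP.
have := nl; rewrite -(cs_mem sysK) => /flattenP[K Kin vK].
rewrite (prevs_in (cs_uniq sysK) Kin vK).
by have /eqP := prev_cycle (allP (cs_cycle sysK) _ Kin) vK.
Qed.

End System.
End Plan.

(** * Assignments *)

Section Existence.

Variables (R : realFieldType) (V C : finType) (I : instance R V C).
Hypothesis starI : star_instance I.

Local Notation u := (centre I).
Local Notation P ls := (run 1%g (centre_swaps u ls)).

(** The transpositions that involve [u] generate the symmetric group. This supplies a first solution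
    for every bijective assignment. *)
Lemma centre_run_surj (p : {perm V}) : exists2 ls, u \notin ls & P ls = p.
Proof.
have : p \in <<[set tperm u y | y in V]>>%g by rewrite gen_tperm inE.
case/gen_prodgP=> n [c cP ->] {p}.
elim: n c cP => [|n IH] c cP.
  by exists [::]; rewrite //= big_ord0.
rewrite big_ord_recr /=.
have [ls uls <-] := IH (fun i => c (widen_ord (leqnSn n) i)) (fun i => cP _).
have /imsetP[y _ ->] := cP ord_max.
have [<-|uy] := eqVneq u y; first by exists ls => //; rewrite tperm1 mulg1.
exists (y :: ls); first by rewrite inE negb_or uy.
by rewrite /= run_mul /swap mulg1.
Qed.

Lemma cost_from_cat s a b :
  cost_from I s (a ++ b) = cost_from I s a + cost_from I (run s a) b.
Proof. by elim: a s => [|e a IH] s /=; rewrite ?add0r // IH addrA. Qed.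

Lemma cost_from_ge0 s a : 0 <= cost_from I s a.
Proof.
elim: a s => //= e a IH s; rewrite !addr_ge0 ?IH //; exact: ltW (om_gt0 starI _).
Qed.

(* Repeated placements can be cut out, which makes the search for a minimum
   finite although R need not be archimedean. *)
Lemma shorten_swaps sigma : exists sigma', [/\ (size sigma' <= #|{: {perm V}}|)%N,
  run 1%g sigma' = run 1%g sigma, cost I sigma' <= cost I sigma
  & swap_sequence I sigma -> swap_sequence I sigma'].
Proof.
have [n] := ubnP (size sigma); elim: n sigma => // n IH sigma; rewrite ltnS => szn.
have [le|lt] := leqP (size sigma) #|{: {perm V}}|; first by exists sigma.
pose st := [seq run 1%g (take i sigma) | i <- iota 0 (size sigma)].
have /(uniqPn 1%g)[i [j [ij]]] : ~~ uniq st.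
  apply: contraL lt => /card_uniqP cst; rewrite -leqNgt.
  have <- : size st = size sigma by rewrite size_map size_iota.
  by rewrite -cst; apply: max_card.
rewrite size_map size_iota => jn; have ilt := ltn_trans ij jn.
rewrite !(nth_map 0%N) ?size_iota // !nth_iota // !add0n => stE.
pose sg := take i sigma ++ drop j sigma.
have szg : (size sg < size sigma)%N.
  by rewrite size_cat size_take size_drop ilt; lia.
have [sg' [sz' run' cost' sw']] := IH sg (leq_trans szg szn).
exists sg'; split=> //.
- by rewrite run' -[in RHS](cat_take_drop j sigma) !run_cat stE.
- apply: le_trans cost' _; rewrite -[in leRHS](cat_take_drop j sigma).
  rewrite /cost !cost_from_cat stE.
  rewrite lerD2r -[in leRHS](cat_take_drop i (take j sigma)) take_takel; last exact: ltnW.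
  by rewrite cost_from_cat lerDl cost_from_ge0.
move=> sw; apply: sw'; move: sw; rewrite /swap_sequence all_cat => sw.
apply/andP; split.
  by move: sw; rewrite -{1}(cat_take_drop i sigma) all_cat => /andP[].
by move: sw; rewrite -{1}(cat_take_drop j sigma) all_cat => /andP[].
Qed.

Lemma Fcost_exists T : bijective T -> exists x, Fcost I T x.
Proof.
move=> [T' TK T'K]; pose N := #|{: {perm V}}|.
pose Q (a : N.-bseq (V * V)) := swap_sequence I a && [forall v, T (run 1%g a v) == v].
have short sigma : solves_uncoloured I T sigma ->
    exists2 a, Q a & cost I a <= cost I sigma.
  move=> [sw sol]; have [sg [sz rsg csg swg]] := shorten_swaps sigma.
  exists (Bseq sz) => //; rewrite /Q swg //=.
  by apply/forallP => v; rewrite rsg sol.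
have injT' : injective T' by apply: can_inj T'K.
have [ls uls Pls] := centre_run_surj (perm injT').
have [|a0 Qa0 _] := short (centre_swaps u ls).
  split=> [|v]; first by rewrite swap_sequence_centre.
  by rewrite Pls permE.
case: (arg_minP (fun a : N.-bseq (V * V) => cost I a) Qa0) => a Qa amin.
exists (cost I a); split.
  exists (val a) => //; case/andP: Qa => sw /forallP sol; split=> // v.
  exact/eqP/sol.
by move=> x [sigma /short[b Qb le] <-]; apply: le_trans le; apply: amin.
Qed.

Lemma uncoloured_coloured T sigma : token_vertex_assignment I T ->
  solves_uncoloured I T sigma -> solves_coloured I sigma.
Proof. by move=> [_ Tc] [sw sol]; split=> // v; rewrite -Tc sol. Qed.

End Existence.

(** * Circuit systems and the assignments [T_A] *)

Section Assignment.

Variables (R : realFieldType) (V C : finType) (I : instance R V C).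
Hypothesis starI : star_instance I.

Local Notation u := (centre I).
Local Notation P ls := (run 1%g (centre_swaps u ls)).
Local Notation Z := [seq v <- enum V | leaf_loop I v].

Lemma loopsP z : (z \in Z) = leaf_loop I z.
Proof. by rewrite mem_filter mem_enum andbT. Qed.

Lemma centre_not_loop : ~~ leaf_loop I u.
Proof. by rewrite /leaf_loop leafE // eqxx. Qed.

Lemma G'_adj_sym : symmetric (G'_adj I).
Proof. by move=> c d; apply: eq_existsb => v; rewrite orbC. Qed.

Lemma G'_adj_edge v : ~~ leaf_loop I v -> G'_adj I (vcol I v) (tcol I v).
Proof. by move=> nl; apply/exists_inP; exists v; rewrite ?inE ?nl // !eqxx. Qed.

Lemma connect_G'_cycle (K : seq V) v w :
  path.cycle (follows (vcol I) (tcol I)) K ->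
  (forall x, x \in K -> ~~ leaf_loop I x) -> v \in K -> w \in K ->
  connect (G'_adj I) (vcol I v) (vcol I w).
Proof.
move=> cK nlK vK wK.
have cK' : path.cycle [rel x y | ~~ leaf_loop I x && (tcol I x == vcol I y)] K.
  apply: (sub_in_cycle (P := mem K)) cK; last exact/allP.
  by move=> x y xK _; rewrite /follows /= => ->; rewrite nlK.
have /connectP[p pth ->] := connect_cycle cK' vK wK.
elim: p v pth {vK} => [|y p IH] v /=; first by rewrite connect0.
case/andP=> /andP[nl /eqP vy] /IH; apply: connect_trans.
by rewrite -vy; apply/connect1/G'_adj_edge.
Qed.

Section OfSystem.

Variables (K0 : seq V) (Ks : seq (seq V)).
Hypothesis sysK : circuit_system I K0 Ks.

Lemma system_circuit_uniq K : K \in K0 :: Ks -> uniq K.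
Proof.
have := cs_uniq sysK; elim: (K0 :: Ks) => //= K' L IH; rewrite cat_uniq.
by case/and3P=> uK' _ uL; rewrite inE => /predU1P[->|/IH] //; apply.
Qed.

Lemma system_circuit_edge K v : K \in K0 :: Ks -> v \in K -> ~~ leaf_loop I v.
Proof.
by move=> Kin vK; rewrite -(cs_mem sysK); apply/flattenP; exists K.
Qed.

Lemma circuit_index_connect c d : connect (G'_adj I) c d ->
  circuit_index I K0 Ks c = circuit_index I K0 Ks d.
Proof.
case/connectP=> p pth ->; elim: p c pth => //= d' p IH c /andP[cd /IH <-].
case/exists_inP: cd => v _ /orP[] /andP[/eqP <- /eqP <-]; first exact: circuit_index_edge.
by rewrite (circuit_index_edge sysK).
Qed.

(** The circuit index is constant on a component of G' and determines the circuit. *)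
Lemma system_component K c v : K \in K0 :: Ks -> v \in K ->
  connect (G'_adj I) c (vcol I v) -> eulerian_circuit I (G'_component I c) K.
Proof.
move=> Kin vK cv; have cK := allP (cs_cycle sysK) _ Kin.
split=> //; first exact: system_circuit_uniq.
move=> w; rewrite !inE; apply/idP/andP => [wK|[nl cw]].
  split; first exact: system_circuit_edge Kin wK.
  apply: connect_trans cv _; apply: (connect_G'_cycle cK) => // x.
  exact: system_circuit_edge.
have [i lin wi] := circuit_of sysK nl.
have KE : nth [::] (K0 :: Ks) (index K (K0 :: Ks)) = K by rewrite nth_index.
have lt : (index K (K0 :: Ks) < (size Ks).+1)%N.
  by rewrite -[X in (_ < X)%N]/(size (K0 :: Ks)) index_mem.
rewrite -{1}KE in vK.
suff -> : K = nth [::] (K0 :: Ks) i by [].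
rewrite -KE -(circuit_index_vcol sysK lin wi) -(circuit_index_vcol sysK lt vK).
congr nth; rewrite -(circuit_index_connect cw).
by rewrite -(circuit_index_connect cv).
Qed.

Lemma system_TA : exists T, is_TA I T.
Proof.
have [_ PE _] := plan_leavesP sysK loopsP.
(* [p] sends a vertex to the token that ends there; the assignment goes the other way. *)
set p := P _ in PE; exists (p^-1)%g; split=> [v lv|c].
  apply: (canLR (permK p)); rewrite PE prevs_notin //.
  by rewrite (cs_mem sysK) negbK.
have [/existsP[v /andP[nl cv]]|nv] :=
    boolP [exists v, ~~ leaf_loop I v && connect (G'_adj I) c (vcol I v)].
  have := nl; rewrite -(cs_mem sysK) => /flattenP[K Kin vK].
  exists K; first exact: system_component Kin vK cv.
  move=> w wK; apply: (canLR (permK p)); rewrite PE.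
  rewrite (prevs_in (cs_uniq sysK) Kin); last by rewrite mem_next.
  by rewrite prev_next // system_circuit_uniq.
exists [::] => //; split=> // v; rewrite !inE.
by apply/esym/negbTE; apply: contra nv => nv; apply/existsP; exists v.
Qed.

(** The plan reaches exactly the placement prescribed by [T], so an optimum of the coloured instance
    already solves the uncoloured one. *)
Lemma system_next T : (forall v, leaf_loop I v -> T v = v) ->
  (forall K v, K \in K0 :: Ks -> v \in K -> T v = next K v) ->
  token_vertex_assignment I T /\
  exists sigma, [/\ solves_uncoloured I T sigma,
    solves_coloured I sigma & forall sigma', solves_coloured I sigma' ->
      cost I sigma <= cost I sigma'].
Proof.
move=> Tl TK.
have [uls PE _] := plan_leavesP sysK loopsP.
have TP v : T (P (plan_leaves I K0 Ks Z) v) = v.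
  rewrite PE; have [lv|nl] := boolP (leaf_loop I v).
    by rewrite prevs_notin ?Tl // (cs_mem sysK) negbK.
  have := nl; rewrite -(cs_mem sysK) => /flattenP[K Kin vK].
  rewrite (prevs_in (cs_uniq sysK) Kin vK) (TK K) // ?mem_prev //.
  by rewrite next_prev // system_circuit_uniq.
have su : solves_uncoloured I T (centre_swaps u (plan_leaves I K0 Ks Z)).
  by split=> //; rewrite swap_sequence_centre.
have tv : token_vertex_assignment I T.
  split.
    exists (P (plan_leaves I K0 Ks Z)) => // v.
    by rewrite -{1}[v](permKV (P (plan_leaves I K0 Ks Z))) TP permKV.
  move=> t; have [lt|nl] := boolP (leaf_loop I t).
    by rewrite Tl //; case/andP: lt => _ /eqP.
  have := nl; rewrite -(cs_mem sysK) => /flattenP[K Kin tK].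
  rewrite (TK K) //; apply/esym/eqP.
  exact: next_cycle (allP (cs_cycle sysK) _ Kin) tK.
split=> //; exists (centre_swaps u (plan_leaves I K0 Ks Z)); split=> //.
- exact: uncoloured_coloured tv su.
- by move=> sigma'; apply: plan_optimal => //; apply: loopsP.
Qed.

End OfSystem.

Lemma uniq_flatten_disjoint (Ks : seq (seq V)) : all uniq Ks ->
  pairwise (allrel (fun v w => vcol I v != vcol I w)) Ks -> uniq (flatten Ks).
Proof.
elim: Ks => //= K Ks IH /andP[uK uKs] /andP[/allP dj dKs].
rewrite cat_uniq uK IH // andbT /=; apply/hasP => -[v /flattenP[K' K'in vK'] vK].
by have /allrelP/(_ _ _ vK vK') := dj _ K'in; rewrite eqxx.
Qed.

(** The hypothesis gives one circuit per colour, hence several lists for the same component. Only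
    the list of a root of each component is kept, and the circuit of the centre is rotated to begin
    at [u], which leaves [next] unchanged. *)
Lemma TA_system T : is_TA I T -> exists K0 Ks, circuit_system I K0 Ks /\
  (forall K v, K \in K0 :: Ks -> v \in K -> T v = next K v).
Proof.
move=> [Tl /fin_all_exists2[s sE sT]].
have csym : connect_sym (G'_adj I) by apply: sym_connect_sym G'_adj_sym.
have smem c v : (v \in s c) = ~~ leaf_loop I v && connect (G'_adj I) c (vcol I v).
  by case: (sE c) => _ -> _; rewrite !inE.
have us : u \in s (vcol I u) by rewrite smem centre_not_loop connect0.
have [i K0' rotE] := rot_to us.
pose rt := fingraph.root (G'_adj I).
pose reps := [seq c <- enum C | [&& rt c == c, c != rt (vcol I u) & s c != [::]]].
have memr c v : (v \in s c) -> rt (vcol I v) = rt c.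
  by rewrite smem => /andP[_ cv]; apply/esym/eqP; rewrite root_connect.
have memK0 v : (v \in u :: K0') = (v \in s (vcol I u)) by rewrite -rotE mem_rot.
have uqs c : uniq (s c) by case: (sE c).
have dj : pairwise (allrel (fun v w => vcol I v != vcol I w)) ((u :: K0') :: map s reps).
  rewrite pairwise_cons; apply/andP; split.
    apply/allP => K /mapP[c]; rewrite mem_filter => /andP[/and3P[/eqP rc cu _] _] ->.
    apply/allrelP => v w; rewrite memK0 => /memr rv /memr rw.
    by apply: contraNneq cu => vw; rewrite -rv vw rw rc.
  rewrite pairwise_map.
  have : uniq reps by rewrite filter_uniq // enum_uniq.
  rewrite uniq_pairwise; apply: (sub_in_pairwise (P := fun c => rt c == c)); last first.
    by apply/allP => c; rewrite mem_filter => /andP[/and3P[]].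
  move=> c d /eqP rc /eqP rd /= cd; apply/allrelP => v w /memr rv /memr rw.
  by apply: contraNneq cd => vw; rewrite -rc -rd -rv vw rw.
exists (u :: K0'), (map s reps); split.
  split=> //.
  - apply: uniq_flatten_disjoint => //=; rewrite -[_ && uniq K0']/(uniq (u :: K0')).
    rewrite -rotE rot_uniq uqs /=; apply/allP => K /mapP[c _ ->]; exact: uqs.
  - move=> v; apply/flattenP/idP => [[K]|nl].
      rewrite inE => /predU1P[->|/mapP[c _ ->]]; first by rewrite memK0 smem => /andP[].
      by rewrite smem => /andP[].
    have [ru|ru] := eqVneq (rt (vcol I v)) (rt (vcol I u)).
      exists (u :: K0'); first exact: mem_head.
      by rewrite memK0 smem nl /= -root_connect //; apply/eqP.
    have vs : v \in s (rt (vcol I v)).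
      by rewrite smem nl csym connect_root.
    exists (s (rt (vcol I v))) => //; rewrite inE; apply/orP; right.
    apply: map_f; rewrite mem_filter mem_enum inE andbT ru /rt root_root // eqxx /=.
    by apply: contraTneq vs => ->.
  - by apply/allP => K /mapP[c]; rewrite mem_filter => /andP[/and3P[_ _ ?] _] ->.
  - apply/allP => K; rewrite inE => /predU1P[->|/mapP[c _ ->]].
      by rewrite -rotE rot_cycle; case: (sE (vcol I u)).
    by case: (sE c).
move=> K v; rewrite inE => /predU1P[->|/mapP[c _ ->]]; last exact: sT.
by rewrite memK0 => vs; rewrite -rotE next_rot //; apply: sT.
Qed.

Definition plain_edges : seq V :=
  [seq v <- enum V | (v != u) && (vcol I v != tcol I v)].

Definition euler_centre : seq V * seq V :=
  euler_from (vcol I) (tcol I) u plain_edges.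

Definition other_circuits : seq (seq V) :=
  circuits (vcol I) (tcol I) (size euler_centre.2) euler_centre.2.

Lemma mem_plain_edges v : (v \in u :: plain_edges) = ~~ leaf_loop I v.
Proof.
rewrite inE mem_filter mem_enum inE andbT /leaf_loop leafE // negb_and negbK.
by case: eqP.
Qed.

Lemma uniq_plain_edges : uniq (u :: plain_edges).
Proof. by rewrite /= mem_filter eqxx /= filter_uniq // enum_uniq. Qed.

(** All edges together are balanced because each colour has as many tokens as vertices, and the leaf
    loops are balanced by themselves. *)
Lemma balanced_plain_edges : balanced (vcol I) (tcol I) (u :: plain_edges).
Proof.
have pe : perm_eq (Z ++ (u :: plain_edges)) (enum V).
  apply: uniq_perm; rewrite ?enum_uniq //.
    rewrite cat_uniq filter_uniq ?enum_uniq // uniq_plain_edges andbT andTb.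
    apply/hasP => -[v]; rewrite mem_plain_edges => /negP nl.
    by rewrite /= loopsP.
  by move=> v; rewrite mem_cat loopsP mem_plain_edges mem_enum inE orbN.
apply: (balanced_catr (s := Z)); last first.
  apply: (balanced_perm (s := enum V)); first by rewrite perm_sym.
  have cardE p : #|[set v | p v]| = count p (enum V).
    rewrite cardsE cardE {1}/enum_mem -enumT size_filter.
    exact: eq_count.
  by move=> c; case: starI => _ cnt _; rewrite -!cardE.
move=> c; rewrite !count_filter; apply: eq_count => v /=.
by rewrite /leaf_loop; case: (vcol I v =P tcol I v) => [->|_]; rewrite ?andbF.
Qed.

Lemma algorithm_system : circuit_system I euler_centre.1 other_circuits.
Proof.
have := euler_fromP balanced_plain_edges; rewrite /other_circuits -/euler_centre.
case: euler_centre => K0 rest /= [pc [nK0 hK0] cK0 bal dj].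
have [pf nn cy pw] := circuitsP (leqnn (size rest)) bal.
have pall : perm_eq
    (K0 ++ flatten (circuits (vcol I) (tcol I) (size rest) rest))
    (u :: plain_edges).
  by apply: perm_trans pc; rewrite perm_cat2l.
split=> //=.
- by rewrite (perm_uniq pall) uniq_plain_edges.
- by move=> v; rewrite (perm_mem pall) mem_plain_edges.
- by case: (K0) nK0 hK0 => //= x s _ ->.
- by rewrite cK0.
rewrite pw andbT; apply/allP => K Kin; apply/allrelP => v w vK wK.
move/allrelP: dj; apply=> //; rewrite -(perm_mem pf).
by apply/flattenP; exists K.
Qed.

End Assignment.

(** A solution for any assignment is a coloured solution, so the coloured optimum bounds every F(T)
    from below; the plan for [TA] attains it. *)
Lemma TA_optimal (R : realFieldType) (V C : finType) (I : instance R V C) :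
  star_instance I ->
  [/\ (exists TA : V -> V, is_TA I TA),
      (forall T : V -> V, token_vertex_assignment I T ->
         exists x : R, Fcost I T x)
    & forall TA : V -> V, is_TA I TA ->
      [/\ token_vertex_assignment I TA,
          (forall sigma : seq (V * V),
             optimal I (solves_uncoloured I TA) sigma ->
             optimal I (solves_coloured I) sigma)
        & exists m : R,
          [/\ Fcost I TA m,
              is_minimum (fun x : R => exists2 T : V -> V,
                token_vertex_assignment I T & Fcost I T x) m
            & min_cost I (solves_coloured I) m]]].
Proof.
move=> starI; split.
- exact: system_TA (algorithm_system starI).
- by move=> T [bT _]; apply: Fcost_exists.
move=> TA ta; have [K0 [Ks [sysK TK]]] := TA_system starI ta.
have [tv [sg [su sc smin]]] := system_next starI sysK (proj1 ta) TK.
have FTA : Fcost I TA (cost I sg).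
  split; first by exists sg.
  by move=> x [s' /(uncoloured_coloured tv)/smin le <-].
split=> //.
- move=> sigma [ssol sopt]; split; first exact: uncoloured_coloured tv ssol.
  by move=> s' /smin; apply: le_trans; apply: sopt.
exists (cost I sg); split=> //.
- split; first by exists TA.
  move=> x [T tT [[s' /(uncoloured_coloured tT)/smin le <-] _]]; exact: le.
- split; first by exists sg.
  by move=> x [s' /smin le <-].
Qed.

(** * Polynomial bounds *)

Definition poly_bounded (f : nat -> nat) : Prop :=
  exists k, forall n, (f n <= k * n ^ k + k)%N.

Lemma muln_exp0 k : (k * 0 ^ k = 0)%N.
Proof. by case: k => // k; rewrite exp0n ?muln0. Qed.

Lemma poly_bounded_const c : poly_bounded (fun => c).
Proof. by exists c => n; apply: leq_addl. Qed.

Lemma poly_bounded_id : poly_bounded id.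
Proof. by exists 1%N => n; rewrite mul1n expn1; apply: leq_addr. Qed.

Lemma poly_bounded_add f g : poly_bounded f -> poly_bounded g ->
  poly_bounded (fun n => f n + g n)%N.
Proof.
move=> [k fk] [l gl]; exists (k + l)%N => -[|n].
  apply: leq_trans (leq_add (fk 0%N) (gl 0%N)) _.
  by rewrite !muln_exp0.
apply: leq_trans (leq_add (fk n.+1) (gl n.+1)) _.
have : (n.+1 ^ k <= n.+1 ^ (k + l))%N by rewrite leq_pexp2l ?leq_addr.
have : (n.+1 ^ l <= n.+1 ^ (k + l))%N by rewrite leq_pexp2l ?leq_addl.
nia.
Qed.

Lemma poly_bounded_mul f g : poly_bounded f -> poly_bounded g ->
  poly_bounded (fun n => f n * g n)%N.
Proof.
move=> [k fk] [l gl]; exists (4 * (k * l) + k + l)%N => -[|n].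
  apply: leq_trans (leq_mul (fk 0%N) (gl 0%N)) _.
  by rewrite !muln_exp0; lia.
apply: leq_trans (leq_mul (fk n.+1) (gl n.+1)) _.
(* With both powers [a], [b] at least 1, each factor at most doubles when its constant is absorbed,
   which gives [4 * (k * l)]; the terms [k + l] make room for the exponent. *)
set e := (4 * (k * l) + k + l)%N.
have le : (n.+1 ^ (k + l) <= n.+1 ^ e)%N by rewrite leq_pexp2l // /e; lia.
apply: (@leq_trans (4 * (k * l) * n.+1 ^ (k + l))); last first.
  apply: leq_trans (leq_addr _ _); apply: leq_mul => //; rewrite /e; lia.
rewrite expnD.
have : (0 < n.+1 ^ k)%N by rewrite expn_gt0.
have : (0 < n.+1 ^ l)%N by rewrite expn_gt0.
move: (n.+1 ^ k)%N (n.+1 ^ l)%N => a b b0 a0.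
apply: (@leq_trans ((2 * k * a) * (2 * l * b))); last by lia.
apply: leq_mul; nia.
Qed.

(** * The program *)

(* Functions are called by their position in [swap_program].  The comment above
   a body shows the layout of its argument.  An edge of G is encoded by
   [enc_edge], a split circuit by [enc_split]. *)

Definition edge_weight := EFst.
Definition edge_index e := EFst (ESnd e).
Definition edge_src e := EFst (ESnd (ESnd e)).
Definition edge_tgt e := ESnd (ESnd (ESnd e)).

Local Notation x0 := (EVar 0).
Local Notation x1 := (EVar 1).
Local Notation x2 := (EVar 2).
Local Notation x3 := (EVar 3).
Local Notation x5 := (EVar 5).

(* (a, b) |-> a == b *)
Definition eq_body : expr :=
  EIf (EFst x0)
    (EIf (ESnd x0) (ECall 1 (EPair (ESnd (EFst x0)) (ESnd (ESnd x0)))) ENil)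
    (EIf (ESnd x0) ENil (EPair ENil ENil)).

(* (i, s) |-> the i-th item of s *)
Definition nth_body : expr :=
  EIf (EFst x0) (ECall 2 (EPair (ESnd (EFst x0)) (ESnd (ESnd x0))))
    (EFst (ESnd x0)).

(* (i, (colours, weights)) |-> the edges, numbered from i *)
Definition edges_body : expr :=
  EIf (EFst (ESnd x0))
    (ELet (ECall 2 (EPair (ESnd (EFst (EFst (ESnd x0)))) (ESnd (ESnd x0))))
    (ELet (ECall 3 (EPair (EPair ENil (EFst x1))
                      (EPair (ESnd (EFst (ESnd x1))) (ESnd (ESnd x1)))))
      (EPair (EPair x1 (EPair (EFst x2) (EFst (EFst (ESnd x2))))) x0)))
    ENil.

(* (centre, edges) |-> (edge of the centre, (plain edges, leaf loops)) *)
Definition classify_body : expr :=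
  EIf (ESnd x0)
    (ELet (ECall 4 (EPair (EFst x0) (ESnd (ESnd x0))))
    (ELet (ECall 1 (EPair (EFst x1) (edge_index (EFst (ESnd x1)))))
      (EIf x0 (EPair (EFst (ESnd x2)) (ESnd x1))
        (ELet (ECall 1 (EPair (edge_src (EFst (ESnd x2)))
                              (edge_tgt (EFst (ESnd x2)))))
          (EIf x0
            (EPair (EFst x2) (EPair (EFst (ESnd x2))
                                (EPair (EFst (ESnd x3)) (ESnd (ESnd x2)))))
            (EPair (EFst x2) (EPair (EPair (EFst (ESnd x3)) (EFst (ESnd x2)))
                                (ESnd (ESnd x2)))))))))
    (EPair ENil (EPair ENil ENil)).

(* (c, edges) |-> extract c edges, where None is nil *)
Definition extract_body : expr :=
  EIf (ESnd x0)
    (ELet (ECall 1 (EPair (EFst x0) (edge_src (EFst (ESnd x0)))))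
      (EIf x0 (ESnd x1)
        (ELet (ECall 5 (EPair (EFst x1) (ESnd (ESnd x1))))
          (EIf x0 (EPair (EFst x0) (EPair (EFst (ESnd x2)) (ESnd x0))) ENil))))
    ENil.

(* (stack, (out, rest)) *)
Definition hierholzer_body : expr :=
  EIf (EFst x0)
    (ELet (ECall 5 (EPair (edge_tgt (EFst (EFst x0))) (ESnd (ESnd x0))))
      (EIf x0
        (ECall 6 (EPair (EPair (EFst x0) (EFst x1))
                    (EPair (EFst (ESnd x1)) (ESnd x0))))
        (ECall 6 (EPair (ESnd (EFst x1))
                    (EPair (EPair (EFst (EFst x1)) (EFst (ESnd x1)))
                       (ESnd (ESnd x1)))))))
    (ESnd x0).

(* The items of the list are pairs whose first component is their key. *)
Definition split_min_body : expr :=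
  EIf (ESnd x0)
    (ELet (ECall 7 (ESnd x0))
      (EIf (ELe (EFst (EFst x1)) (EFst (EFst (ESnd x0))))
        (EPair ENil (EPair (EFst x1) (ESnd x1)))
        (EPair (EPair (EFst x1) (EFst x0)) (ESnd x0))))
    (EPair ENil (EPair (EFst x0) ENil)).

(** The weight of the split token is copied to the front, so that a split circuit is itself a keyed
    item and function 7 also finds the lightest circuit. *)
Definition split_circuit_body : expr :=
  ELet (ECall 7 x0) (EPair (EFst (EFst (ESnd x0))) x0).

Definition circuits_body : expr :=
  EIf x0
    (ELet (ECall 6 (EPair (EPair (EFst x0) ENil) (EPair ENil (ESnd x0))))
    (ELet (ECall 8 (EFst x0))
    (ELet (ECall 9 (ESnd x1))
      (EPair x1 x0))))
    ENil.

Definition cat_body : expr :=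
  EIf (EFst x0)
    (ELet (ECall 10 (EPair (ESnd (EFst x0)) (ESnd x0)))
      (EPair (EFst (EFst x1)) x0))
    (ESnd x0).

(* (K, M) *)
Definition insert_at_body : expr :=
  ELet (ECall 10 (EPair (ESnd x0) (ESnd (ESnd (ESnd (EFst x0))))))
    (ECall 10 (EPair (EFst (ESnd (EFst x1)))
                 (EPair (EFst (ESnd (ESnd (EFst x1)))) x0))).

(* (K, M) *)
Definition excursion_body : expr :=
  ELet (ECall 11 x0) (ECall 10 (EPair x0 (EPair (EFst x0) ENil))).

Definition excursions_body : expr :=
  EIf x0
    (ELet (ECall 12 (EPair (EFst x0) ENil))
    (ELet (ECall 13 (ESnd x1))
      (ECall 10 (EPair x1 x0))))
    ENil.

(* (m, (a, s)) *)
Definition add_each_body : expr :=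
  EIf (ESnd (ESnd x0))
    (ELet (ECall 14 (EPair (EFst x0)
                       (EPair (EFst (ESnd x0)) (ESnd (ESnd (ESnd x0))))))
      (EAdd (EFst x1) x0))
    (EFst (ESnd x0)).

(* (c, o), where None is nil *)
Definition cheaper_body : expr :=
  EIf (ESnd x0)
    (EIf (ELe (EFst (ESnd x0)) (EFst (EFst x0))) (ESnd x0) (EFst x0))
    (EFst x0).

(* (m0, Ks) *)
Definition plan_stay_body : expr :=
  ELet (ECall 14 (EPair (EFst x0)
                    (EPair (ESub (EFst x0) (EFst x0)) (ESnd x0))))
  (ELet (ECall 13 (ESnd x1))
    (EPair x1 x0)).

(* (m0, Ks) *)
Definition plan_circ_body : expr :=
  EIf (ESnd x0)
    (ELet (ECall 7 (ESnd x0))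
    (ELet (ECall 10 (EPair (EFst x0) (ESnd (ESnd x0))))
    (ELet (ECall 14 (EPair (EFst (EFst (ESnd x1))) (EPair (EFst x2) x0)))
    (ELet (ECall 13 x1)
    (ELet (ECall 12 (EPair (EFst (ESnd x3)) x0))
      (EPair x2 x0))))))
    ENil.

(* (m0, (Ks, Z)) *)
Definition plan_loop_body : expr :=
  EIf (ESnd (ESnd x0))
    (ELet (ECall 7 (ESnd (ESnd x0)))
    (ELet (ECall 14
             (EPair (edge_weight (EFst (ESnd x0)))
                (EPair (EAdd (EFst x1) (edge_weight (EFst (ESnd x0))))
                   (EFst (ESnd x1)))))
    (ELet (ECall 13 (EFst (ESnd x2)))
    (ELet (ECall 12
             (EPair (EPair (edge_weight (EFst (ESnd x2)))
                       (EPair ENil (EPair (EFst (ESnd x2)) ENil))) x0))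
      (EPair x2 x0)))))
    ENil.

(* (centre, leaves) *)
Definition swaps_body : expr :=
  EIf (ESnd x0)
    (ELet (ECall 19 (EPair (EFst x0) (ESnd (ESnd x0))))
      (EPair (EPair (EFst x1) (edge_index (EFst (ESnd x1)))) x0))
    ENil.

(* (K0, (Ks, Z)) *)
Definition plan_body : expr :=
  ELet (ECall 16 (EPair (EFst (EFst x0)) (EFst (ESnd x0))))
  (ELet (ECall 17 (EPair (EFst (EFst x1)) (EFst (ESnd x1))))
  (ELet (ECall 15 (EPair x1 x0))
  (ELet (ECall 18 (EPair (EFst (EFst x3)) (ESnd x3)))
  (ELet (ECall 15 (EPair x1 x0))
  (ELet (ECall 11 (EPair (EFst x5) (ESnd x0)))
    (ESnd x0)))))).

(** Under six bindings [EVar 6] is the encoded instance; in the sixth, [x3] is the result of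
    [classify_body], whose last part holds the leaf loops. *)
Definition main_body : expr :=
  ELet (ECall 3 (EPair ENil (ESnd x0)))
  (ELet (ECall 4 (EPair (EFst x1) x0))
  (ELet (ECall 6 (EPair (EPair (EFst x0) ENil) (EPair ENil (EFst (ESnd x0)))))
  (ELet (ECall 8 (EFst x0))
  (ELet (ECall 9 (ESnd x1))
  (ELet (ECall 20 (EPair x1 (EPair x0 (ESnd (ESnd x3)))))
    (ECall 19 (EPair (EFst (EVar 6)) x0))))))).

Definition swap_program : program :=
  [:: main_body; eq_body; nth_body; edges_body; classify_body; extract_body;
      hierholzer_body; split_min_body; split_circuit_body; circuits_body;
      cat_body; insert_at_body; excursion_body; excursions_body; add_each_body;
      cheaper_body; plan_stay_body; plan_circ_body; plan_loop_body; swaps_body;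
      plan_body].

(** * Evaluation *)

Section Eval.

Variable R : realFieldType.

Implicit Types (env : seq (data R)) (e : expr) (x y : data R).

(** Branches and bindings are excluded too: what remains evaluates by plain computation, and
    evaluation rules are applied only to [EIf], [ELet] and [ECall]. *)
Fixpoint call_free e : bool :=
  match e with
  | EVar _ | ENil => true
  | EFst e | ESnd e => call_free e
  | EPair e1 e2 | EAdd e1 e2 | ESub e1 e2 | ELe e1 e2 =>
      call_free e1 && call_free e2
  | _ => false
  end.

Fixpoint value env e : data R :=
  match e with
  | EVar i => nth DNil env i
  | EPair e1 e2 => DPair (value env e1) (value env e2)
  | EFst e => dfst (value env e)
  | ESnd e => dsnd (value env e)
  | EAdd e1 e2 => dadd (value env e1) (value env e2)
  | ESub e1 e2 => dsub (value env e1) (value env e2)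
  | ELe e1 e2 => dle (value env e1) (value env e2)
  | _ => DNil
  end.

Fixpoint duration e : nat :=
  match e with
  | EFst e | ESnd e => (duration e).+1
  | EPair e1 e2 | EAdd e1 e2 | ESub e1 e2 | ELe e1 e2 =>
      (duration e1 + duration e2).+1
  | _ => 1
  end.

Lemma eval_call_free p env e : call_free e ->
  eval p env e (value env e) (duration e).
Proof.
elim: e => //=; try by [move=> *; constructor];
  try by [move=> e IH /IH; constructor];
  by move=> e1 IH1 e2 IH2 /andP[/IH1 ? /IH2 ?]; constructor.
Qed.

Definition evaluates env e x (b : nat) : Prop :=
  exists2 t, eval swap_program env e x t & (t <= b)%N.

Definition runs (f : nat) x y (b : nat) : Prop :=
  evaluates [:: x] (nth ENil swap_program f) y b.

Lemma evaluates_le env e x b b' : evaluates env e x b -> (b <= b')%N ->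
  evaluates env e x b'.
Proof. by move=> [t ev tb] bb; exists t => //; apply: leq_trans bb. Qed.

Lemma evaluates_value env e x : call_free e -> value env e = x ->
  evaluates env e x (duration e).
Proof. by move=> cf <-; exists (duration e) => //; apply: eval_call_free. Qed.

Lemma evaluates_if env e e1 e2 x b : call_free e ->
  evaluates env (if dtrue (value env e) then e1 else e2) x b ->
  evaluates env (EIf e e1 e2) x (duration e + b).+1.
Proof.
move=> cf [t ev tb]; exists (duration e + t).+1; last by rewrite ltnS leq_add2l.
exact: eval_if (eval_call_free _ _ cf) ev.
Qed.

Lemma evaluates_call env f e x b : call_free e ->
  runs f (value env e) x b -> evaluates env (ECall f e) x (duration e + b).+1.
Proof.
move=> cf [t ev tb]; exists (duration e + t).+1; last by rewrite ltnS leq_add2l.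
exact: eval_call (eval_call_free _ _ cf) ev.
Qed.

Lemma evaluates_let env f e e' x y b b' : call_free e ->
  runs f (value env e) x b -> evaluates (x :: env) e' y b' ->
  evaluates env (ELet (ECall f e) e') y ((duration e + b).+1 + b').+1.
Proof.
move=> cf /(evaluates_call cf)[t ev tb] [t' ev' tb'].
exists (t + t').+1; first exact: eval_let ev ev'.
by rewrite ltnS leq_add.
Qed.

End Eval.

(** * Correctness and running time of the program *)

(** [body] leaves the time as an existential variable, which the other tactics fill while following
    the code; its comparison with the claimed bound is the last goal. Where branches differ, a
    common bound is fixed with [instantiate]. *)
Ltac body f := rewrite /runs [nth _ _ _]/= /f; eapply evaluates_le.
Ltac eval_if := eapply evaluates_if; [reflexivity | rewrite /=].
Ltac eval_let := eapply evaluates_let; [reflexivity | rewrite /= | ].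
Ltac eval_call := eapply evaluates_call; [reflexivity | rewrite /=].
Ltac eval_value := eapply evaluates_value; [reflexivity | rewrite /=].

Section Lists.

Variable R : realFieldType.

Lemma runs_eq a b :
  runs 1 (DPair (enc_nat R a) (enc_nat R b)) (dbool R (a == b)) (20 * a + 20).
Proof.
elim: a b => [|a IH] [|b]; body eq_body;
  try (eval_if; eval_if; first [by eval_value | eval_call; exact: IH]);
  by rewrite /=; lia.
Qed.

Lemma runs_nth i (s : seq (data R)) :
  runs 2 (DPair (enc_nat R i) (enc_seq s)) (nth DNil s i) (20 * i + 20).
Proof.
elim: i s => [|i IH] s; body nth_body.
- by eval_if; eval_value; case: s.
- by rewrite /=; lia.
- eval_if; eval_call.
  have -> : dsnd (enc_seq s) = enc_seq (behead s) by case: s.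
  by rewrite -nth_behead; exact: IH.
- by rewrite /=; lia.
Qed.

Lemma runs_cat (a b : seq (data R)) :
  runs 10 (DPair (enc_seq a) (enc_seq b)) (enc_seq (a ++ b)) (40 * size a + 20).
Proof.
elim: a => [|x a IH]; body cat_body.
- by eval_if; eval_value.
- by rewrite /=; lia.
- by eval_if; eval_let; [exact: IH | eval_value].
- by rewrite /=; lia.
Qed.

Lemma runs_split_min (T : Type) (enc : T -> data R) (key : T -> R) x s :
  (forall t, dfst (enc t) = DNum (key t)) ->
  let K := split_min key x s in
  runs 7 (enc_seq (map enc (x :: s)))
    (DPair (enc_seq (map enc K.1.1)) (DPair (enc K.1.2) (enc_seq (map enc K.2))))
    (100 * size s + 50).
Proof.
move=> encK; elim: s x => [|y s IH] x /=; body split_min_body.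
- by eval_if; eval_value.
- by rewrite /=; lia.
- eval_if; eval_let; first exact: IH.
  eval_if; rewrite !encK /=; instantiate (1 := 20%N).
  by case: (leP (key x)) => _ /=; eapply evaluates_le; try by eval_value.
- by rewrite /=; lia.
Qed.

Lemma runs_add_each (T : Type) (enc : T -> data R) m a s :
  runs 14 (DPair (DNum m) (DPair (DNum a) (enc_seq (map enc s))))
    (DNum (add_each m a s)) (60 * size s + 20).
Proof.
elim: s => [|x s IH]; body add_each_body.
- by eval_if; eval_value.
- by rewrite /=; lia.
- by eval_if; eval_let; [exact: IH | eval_value].
- by rewrite /=; lia.
Qed.

End Lists.

Section Algorithm.

Variables (R : realFieldType) (V C : finType) (I : instance R V C).

Local Notation u := (centre I).
Local Notation om := (fun v => weight I (tcol I v)).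

Definition enc_edge (v : V) : data R :=
  DPair (DNum (om v))
    (DPair (enc_elt R v) (DPair (enc_elt R (vcol I v)) (enc_elt R (tcol I v)))).

Definition enc_edges (s : seq V) : data R := enc_seq (map enc_edge s).

Definition enc_split (K : split_seq V) : data R :=
  DPair (DNum (split_weight I K))
    (DPair (enc_edges K.1.1) (DPair (enc_edge K.1.2) (enc_edges K.2))).

Definition enc_splits (Ks : seq (split_seq V)) : data R :=
  enc_seq (map enc_split Ks).

Definition enc_plan (c : R * seq V) : data R :=
  DPair (DNum c.1) (enc_edges c.2).

Definition enc_oplan (o : option (R * seq V)) : data R := oapp enc_plan DNil o.

Lemma runs_eq_elt (X : finType) (x y : X) (N : nat) : (#|X| <= N)%N ->
  runs 1 (DPair (enc_elt R x) (enc_elt R y)) (dbool R (x == y)) (20 * N + 20).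
Proof.
move=> XN; have -> : (x == y) = (enum_rank x == enum_rank y :> nat).
  by rewrite val_eqE (inj_eq enum_rank_inj).
apply: evaluates_le (runs_eq _ _ _) _.
have lt : (enum_rank x < N)%N := leq_trans (ltn_ord _) XN.
by move: (nat_of_ord _) lt => r; lia.
Qed.

Lemma enum_rank_cat pre v s : enum V = pre ++ v :: s ->
  enum_rank v = size pre :> nat.
Proof.
move=> E; apply/eqP; rewrite -(nth_uniq v _ _ (enum_uniq V)) ?nth_enum_rank.
- by rewrite E nth_cat ltnn subnn.
- by rewrite -cardE ltn_ord.
- by rewrite E size_cat /= addnS ltnS leq_addr.
Qed.

(** The counter is the length of the part already read, hence the rank of the next vertex. *)
Lemma runs_edges N (pre s : seq V) : (#|C| <= N)%N -> enum V = pre ++ s ->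
  runs 3 (DPair (enc_nat R (size pre))
    (DPair (enc_seq [seq DPair (enc_elt R (vcol I v)) (enc_elt R (tcol I v))
                    | v <- s])
           (enc_seq [seq DNum (weight I c) | c <- enum C])))
    (enc_edges s) (size s * (20 * N + 200) + 20).
Proof.
move=> CN; elim: s pre => [|v s IH] pre E; body edges_body.
- by eval_if; eval_value.
- by rewrite /=; lia.
- eval_if; eval_let.
    apply: evaluates_le (runs_nth _ _) _; instantiate (1 := (20 * N + 20)%N).
    have lt : (enum_rank (tcol I v) < N)%N := leq_trans (ltn_ord _) CN.
    by move: (nat_of_ord _) lt => r; lia.
  eval_let.
    have -> : DPair DNil (enc_nat R (size pre)) = enc_nat R (size (rcons pre v)).
      by rewrite size_rcons.
    by apply: IH; rewrite cat_rcons.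
  eval_value; rewrite (nth_map (tcol I v)) -?cardE ?ltn_ord // nth_enum_rank.
  by rewrite /enc_edges /= /enc_edge /enc_elt (enum_rank_cat E).
- by rewrite /=; lia.
Qed.

Lemma runs_classify N (s : seq V) : star_instance I -> (#|V| <= N)%N -> (#|C| <= N)%N ->
  runs 4 (DPair (enc_elt R u) (enc_edges s))
    (DPair (if u \in s then enc_edge u else DNil)
       (DPair (enc_edges [seq v <- s | (v != u) && (vcol I v != tcol I v)])
              (enc_edges [seq v <- s | leaf_loop I v])))
    (size s * (40 * N + 300) + 20).
Proof.
move=> starI VN CN; elim: s => [|v s IH]; body classify_body.
- by eval_if; eval_value.
- by rewrite /=; lia.
- eval_if; eval_let; first exact: IH.
  eval_let; first exact: runs_eq_elt VN.
  instantiate (1 := (20 * N + 150)%N).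
  rewrite inE /= /leaf_loop leafE // (eq_sym v); case: (eqVneq u v) => [<-|vu] /=.
    by eapply evaluates_le; [eval_if; eval_value | rewrite /=; lia].
  eapply evaluates_le; [eval_if; eval_let; first exact: runs_eq_elt CN|].
    instantiate (1 := 60%N); case: eqP => _ /=.
      by eapply evaluates_le; [eval_if; eval_value | ].
    by eapply evaluates_le; [eval_if; eval_value | ].
  by rewrite /=; lia.
- by rewrite /=; lia.
Qed.

Lemma runs_extract N c (s : seq V) : (#|C| <= N)%N ->
  runs 5 (DPair (enc_elt R c) (enc_edges s))
    (if extract (vcol I) c s is Some (w, r)
     then DPair (enc_edge w) (enc_edges r) else DNil)
    (size s * (20 * N + 200) + 20).
Proof.
move=> CN; elim: s => [|w s IH]; body extract_body.
- by eval_if; eval_value.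
- by rewrite /=; lia.
- eval_if; eval_let; first exact: runs_eq_elt CN.
  instantiate (1 := (size s * (20 * N + 200) + 100)%N).
  case: eqP => _ /=.
    by eapply evaluates_le; [eval_if; eval_value | rewrite /=; lia].
  eapply evaluates_le; [eval_if; eval_let; first exact: IH|].
    instantiate (1 := 50%N); case: extract => [[w' r]|].
      by eapply evaluates_le; [eval_if; eval_value |].
    by eapply evaluates_le; [eval_if; eval_value |].
  by rewrite /=; lia.
- by rewrite /=; lia.
Qed.

(** One step scans the remaining edges once, with a unary comparison of colours at each. *)
Definition hierholzer_time (N : nat) : nat := (N * (20 * N + 200) + 200)%N.

(** The program has no fuel and stops on an empty stack; the bound on [n] ensures that the fuelled
    function stops there too. *)
Lemma runs_hierholzer N n (stack out rest : seq V) : (#|C| <= N)%N ->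
  (size rest <= N)%N -> ((size rest).*2 + size stack < n)%N ->
  let r := hierholzer (vcol I) (tcol I) n stack out rest in
  runs 6 (DPair (enc_edges stack) (DPair (enc_edges out) (enc_edges rest)))
    (DPair (enc_edges r.1) (enc_edges r.2)) (n * hierholzer_time N).
Proof.
move=> CN; elim: n stack out rest => [|n IH] stack out rest //= sN szn.
case: stack szn => [|v stack] /= szn; body hierholzer_body.
- by eval_if; eval_value.
- by rewrite /= /hierholzer_time; lia.
- eval_if; eval_let; first exact: runs_extract CN.
  instantiate (1 := (n * hierholzer_time N + 50)%N).
  case E : extract => [[w r]|].
    have sr : size rest = (size r).+1 := size_extract E.
    eapply evaluates_le; [eval_if; eval_call; apply: (IH (w :: v :: stack) out r) |].
    + by rewrite /= in sr sN *; lia.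
    + by rewrite /= in sr szn *; lia.
    + by rewrite /=; lia.
  eapply evaluates_le; [eval_if; eval_call; apply: (IH stack (v :: out) rest) |].
  + by [].
  + by rewrite /= in szn *; lia.
  + by rewrite /=; lia.
- rewrite /=; have : (size rest * (20 * N + 200) <= N * (20 * N + 200))%N.
    by rewrite leq_mul2r sN orbT.
  have -> : hierholzer_time N = (N * (20 * N + 200) + 200)%N by [].
  rewrite (mulSn n); move: (N * _)%N (size rest * _)%N (n * _)%N => a b c; lia.
Qed.

Lemma runs_split_circuit x s :
  runs 8 (enc_edges (x :: s)) (enc_split (split_circuit I (x :: s)))
    (100 * size s + 100).
Proof.
body split_circuit_body.
- eval_let; first exact: (runs_split_min (enc := enc_edge) (key := om)).
  by eval_value.
- by rewrite /=; lia.
Qed.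

Definition circuit_time (N : nat) : nat :=
  ((2 * N + 2) * hierholzer_time N + 100 * N + 300)%N.

Lemma runs_circuits N n (rest : seq V) : (#|C| <= N)%N -> (size rest <= N)%N ->
  (size rest <= n)%N -> balanced (vcol I) (tcol I) rest ->
  runs 9 (enc_edges rest)
    (enc_splits (map (split_circuit I) (circuits (vcol I) (tcol I) n rest)))
    (n * circuit_time N + 20).
Proof.
move=> CN; elim: n rest => [|n IH] [|b rest] //= sN szn bal; body circuits_body;
  try (by eval_if; eval_value); try by rewrite /=; lia.
- have hr : runs 6 (DPair (enc_edges [:: b]) (DPair (enc_edges [::]) (enc_edges rest)))
    (DPair (enc_edges (euler_from (vcol I) (tcol I) b rest).1)
           (enc_edges (euler_from (vcol I) (tcol I) b rest).2))
    ((2 * N + 2) * hierholzer_time N).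
    apply: evaluates_le (runs_hierholzer _ CN _ _) _; rewrite /=; try lia.
    by rewrite leq_mul2r; apply/orP; right; lia.
  have := euler_fromP bal; case: euler_from hr => circ rest' /= hr.
  case=> pc [nc _] _ br _; have := perm_size pc; rewrite size_cat /= => sz.
  eval_if; eval_let; first exact: hr.
  case: circ nc sz {hr pc} => //= x s _ sz.
  eval_let.
    apply: evaluates_le (runs_split_circuit x s) _.
    by instantiate (1 := (100 * N + 100)%N); lia.
  eval_let; first by apply: IH => //; lia.
  by eval_value.
- by rewrite /= /circuit_time; lia.
Qed.

Lemma runs_insert_at K M :
  runs 11 (DPair (enc_split K) (enc_edges M)) (enc_edges (insert_at K M))
    (40 * size (insert_at K M) + 100).
Proof.
body insert_at_body.
- eval_let; first exact: runs_cat.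
  eval_call; rewrite /enc_edges /insert_at map_cat map_cons map_cat.
  exact: (runs_cat _ (_ :: _)).
- by rewrite /= !size_map /insert_at !size_cat /= size_cat; lia.
Qed.

Lemma runs_excursion K M :
  runs 12 (DPair (enc_split K) (enc_edges M)) (enc_edges (excursion K M))
    (80 * size (excursion K M) + 200).
Proof.
body excursion_body.
- eval_let; first exact: runs_insert_at.
  eval_call; rewrite /enc_edges /excursion -cats1 map_cat /=.
  have -> : dfst (enc_seq (map enc_edge (insert_at K M))) =
            enc_edge (head K.1.2 (insert_at K M)) by case: K => [[[|a A] x] B].
  exact: (runs_cat _ [:: _]).
- by rewrite /excursion size_rcons /= size_map; lia.
Qed.

Lemma size_excursion_gt0 K (M : seq V) : (0 < size (excursion K M))%N.
Proof. by rewrite size_rcons. Qed.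

Lemma runs_excursions Ks :
  runs 13 (enc_splits Ks) (enc_edges (excursions Ks))
    (600 * size (excursions Ks) + 20).
Proof.
elim: Ks => [|K Ks IH]; body excursions_body.
- by eval_if; eval_value.
- by rewrite /=; lia.
- eval_if; eval_let; first exact: (runs_excursion K [::]).
  eval_let; first exact: IH.
  by eval_call; rewrite excursions_cons /enc_edges map_cat; exact: runs_cat.
- rewrite excursions_cons size_cat /= size_map.
  (* Each excursion contains a visit, so the constant cost per circuit is absorbed in the length of
     the output. *)
  by have := size_excursion_gt0 K [::]; lia.
Qed.

Lemma runs_cheaper c o :
  runs 15 (DPair (enc_plan c) (enc_oplan o)) (enc_plan (cheaper c o)) 40.
Proof.
body cheaper_body.
- eval_if; instantiate (1 := 30%N); case: o => [c'|] /=.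
    eapply evaluates_le; [eval_if; instantiate (1 := 10%N) |by []].
    by case: (leP c'.1) => _ /=; eapply evaluates_le; try by eval_value.
  by eapply evaluates_le; [eval_value|].
- by [].
Qed.

Lemma size_excursions_ge (Ks : seq (split_seq V)) :
  (size Ks <= size (excursions Ks))%N.
Proof.
elim: Ks => //= K Ks IH; rewrite excursions_cons size_cat.
by have := size_excursion_gt0 K [::]; lia.
Qed.

Lemma runs_plan_stay m0 Ks :
  runs 16 (DPair (DNum m0) (enc_splits Ks)) (enc_plan (plan_stay m0 Ks))
    (700 * size (excursions Ks) + 200).
Proof.
body plan_stay_body.
- eval_let; first exact: runs_add_each.
  eval_let; first exact: runs_excursions.
  by eval_value.
- by have := size_excursions_ge Ks; rewrite /=; lia.
Qed.

Lemma size_excursion K (M : seq V) :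
  size (excursion K M) = (size (glue K) + size M).+1.
Proof. by rewrite size_rcons /insert_at /glue !size_cat /= size_cat; lia. Qed.

Lemma size_excursions (Ks : seq (split_seq V)) :
  size (excursions Ks) = (size (flatten (map (@glue V) Ks)) + size Ks)%N.
Proof.
elim: Ks => //= K Ks IH.
by rewrite excursions_cons size_cat IH size_excursion (size_cat (glue K)) /=; lia.
Qed.

Lemma runs_plan_circ m0 Ks :
  runs 17 (DPair (DNum m0) (enc_splits Ks)) (enc_oplan (plan_circ I m0 Ks))
    (1200 * size (excursions Ks) + 600).
Proof.
case: Ks => [|K Ks]; body plan_circ_body.
- by eval_if; eval_value.
- by [].
- rewrite /plan_circ [enc_oplan _]/=.
  eval_if; eval_let.
    exact: (runs_split_min (enc := enc_split) (key := split_weight I)).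
  eval_let; first exact: runs_cat.
  rewrite -map_cat; set S := split_min _ _ _.
  eval_let; first exact: (runs_add_each enc_split).
  eval_let; first exact: runs_excursions.
  eval_let; first exact: runs_excursion.
  by eval_value.
- have := split_min_cat (split_weight I) K Ks.
  have := size_excursions_ge (K :: Ks).
  move: (split_min _ _ _) => [[A K'] B] /= szE E.
  rewrite size_map -E size_excursion !size_excursions !map_cat !flatten_cat /= in szE *.
  rewrite !(size_cat (flatten _)) (size_cat (glue K')) !(size_cat A) /= in szE *.
  by have := congr1 size E; rewrite size_cat /= size_cat; lia.
Qed.

Lemma runs_plan_loop m0 Ks Z :
  runs 18 (DPair (DNum m0) (DPair (enc_splits Ks) (enc_edges Z)))
    (enc_oplan (plan_loop I m0 Ks Z))
    (1200 * size (excursions Ks) + 100 * size Z + 800).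
Proof.
case: Z => [|z Z]; body plan_loop_body.
- by eval_if; eval_value.
- by rewrite /=; lia.
- rewrite /plan_loop [enc_oplan _]/=.
  eval_if; eval_let; first exact: (runs_split_min (enc := enc_edge) (key := om)).
  eval_let; first exact: runs_add_each.
  eval_let; first exact: runs_excursions.
  eval_let; first exact: (runs_excursion ([::], _, [::])).
  by eval_value.
- by have := size_excursions_ge Ks; rewrite size_excursion /glue /=; lia.
Qed.

Lemma runs_swaps c ls :
  runs 19 (DPair (enc_elt R c) (enc_edges ls)) (enc_swaps R (centre_swaps c ls))
    (60 * size ls + 20).
Proof.
elim: ls => [|l ls IH]; body swaps_body.
- by eval_if; eval_value.
- by rewrite /=; lia.
- by eval_if; eval_let; [exact: IH | eval_value].
- by rewrite /=; lia.
Qed.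

(** The two additional visits are those to the leaf loop in [plan_loop]. *)
Lemma size_plan_middle m0 Ks Z :
  (size (plan_middle I m0 Ks Z).2 <= size (excursions Ks) + 2)%N.
Proof.
have cheap c o : (size c.2 <= size (excursions Ks) + 2)%N ->
    (forall c', o = Some c' -> (size c'.2 <= size (excursions Ks) + 2)%N) ->
    (size (cheaper c o).2 <= size (excursions Ks) + 2)%N.
  by move=> sc; case: o => //= c' so; case: ifP => // _; apply: so.
rewrite /plan_middle; apply: (cheap); first apply: (cheap).
- exact: leq_addr.
- rewrite /plan_circ; case: Ks {cheap} => // K Ks c' [<-].
  have := split_min_cat (split_weight I) K Ks.
  move: (split_min _ _ _) => [[A K'] B] /= E; rewrite -E.
  rewrite size_excursion !size_excursions !map_cat !flatten_cat /=.
  by rewrite !(size_cat (flatten _)) (size_cat (glue K')) !(size_cat A) /=; lia.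
- rewrite /plan_loop; case: Z => // z Z c' [<-].
  by rewrite size_excursion /glue /=; lia.
Qed.

Lemma runs_plan K0 Ks Z :
  runs 20 (DPair (enc_split K0) (DPair (enc_splits Ks) (enc_edges Z)))
    (enc_edges (plan I K0 Ks Z))
    (4000 * size (excursions Ks) + 40 * size (glue K0) + 100 * size Z + 3000).
Proof.
body plan_body.
- eval_let; first exact: runs_plan_stay.
  eval_let; first exact: runs_plan_circ.
  eval_let; first exact: runs_cheaper.
  eval_let; first exact: runs_plan_loop.
  eval_let; first exact: runs_cheaper.
  eval_let; first exact: runs_insert_at.
  eval_value; rewrite /plan /plan_middle.
  by case: (insert_at _ _).
- have := size_plan_middle (split_weight I K0) Ks Z.
  rewrite /plan_middle /insert_at /glue !size_cat /= !size_cat; lia.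
Qed.

End Algorithm.

(** In order: listing the edges, classifying them, the circuit of the centre, the other circuits;
    the last summand covers the calls of linear cost and the constants. *)
Definition main_time (N : nat) : nat :=
  (N * (20 * N + 200) + N * (40 * N + 300) + (2 * N + 2) * hierholzer_time N
   + N * circuit_time N + (100 * (100 * N) + 4500))%N.

Lemma poly_bounded_main_time : poly_bounded main_time.
Proof.
rewrite /main_time /circuit_time /hierholzer_time.
repeat first [exact: poly_bounded_id | exact: poly_bounded_const
             | apply: poly_bounded_add | apply: poly_bounded_mul].
Qed.

Section Main.

Variables (R : realFieldType) (V C : finType) (I : instance R V C).
Hypothesis starI : star_instance I.

Local Notation u := (centre I).
Local Notation K0 := (euler_centre I).1.
Local Notation Ks := (other_circuits I).
Local Notation Z := [seq v <- enum V | leaf_loop I v].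

Definition optimal_leaves : seq V := plan_leaves I K0 Ks Z.

Lemma uniq_size_le (s : seq V) : uniq s -> (size s <= #|V|)%N.
Proof. by move/card_uniqP <-; apply: max_card. Qed.

Lemma size_filter_enum (p : pred V) : (size [seq v <- enum V | p v] <= #|V|)%N.
Proof. by apply: uniq_size_le; rewrite filter_uniq ?enum_uniq. Qed.

Lemma runs_main : runs 0 (enc_instance I)
  (enc_swaps R (centre_swaps u optimal_leaves)) (main_time (#|V| + #|C|)).
Proof.
set N := (#|V| + #|C|)%N.
have VN : (#|V| <= N)%N by apply: leq_addr.
have CN : (#|C| <= N)%N by apply: leq_addl.
have sys := algorithm_system starI.
have sK : (size K0 + size (flatten Ks) <= N)%N.
  rewrite -size_cat; apply: leq_trans VN; apply: uniq_size_le.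
  exact: (cs_uniq sys).
have sKs : (size Ks <= size (flatten Ks))%N.
  have := cs_nonempty sys; elim: (Ks) => //= K L IH /andP[nK /IH]; rewrite size_cat.
  by case: (K) nK => //= x s _; lia.
have sZ : (size Z <= N)%N by apply: leq_trans VN; apply: size_filter_enum.
have sD : (size (plain_edges I) <= N)%N.
  by apply: leq_trans VN; apply: size_filter_enum.
(* One return visit per circuit, and circuits are nonempty: hence the factor 2. *)
have sX : (size (excursions (map (split_circuit I) Ks)) <= 2 * N)%N.
  by rewrite size_excursions size_map (glue_Ss sys); lia.
have K0E : glue (split_circuit I K0) = K0 by rewrite split_circuitK // (K0_neq0 sys).
have srest : (size (euler_centre I).2 <= N)%N.
  have := euler_fromP (balanced_plain_edges starI); rewrite -/(euler_centre I).
  case: (euler_centre I) => circ rest /= [/perm_size + [nc _] _ _ _].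
  by rewrite size_cat /=; case: (circ) nc => //= x s _; lia.
have [x [s K0c]] : exists x s, K0 = x :: s.
  by rewrite (cs_centre sys); do 2!eexists.
have sls : (size optimal_leaves <= 3 * N + 2)%N.
  rewrite /optimal_leaves /plan_leaves /plan size_behead.
  have := size_plan_middle I (split_weight I (split_circuit I K0))
            (map (split_circuit I) Ks) Z.
  move: K0E => /(congr1 size); rewrite /insert_at /glue !size_cat /= !size_cat.
  by lia.
body main_body.
- eval_let.
    eapply evaluates_le; 
      first exact: (@runs_edges R V C I N [::] (enum V) CN erefl).
    rewrite -cardE; instantiate (1 := (N * (20 * N + 200) + 20)%N).
    by rewrite leq_add2r leq_mul2r VN orbT.
  eval_let.
    apply: evaluates_le (runs_classify (enum V) starI VN CN) _.
    rewrite -cardE; instantiate (1 := (N * (40 * N + 300) + 20)%N).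
    by rewrite leq_add2r leq_mul2r VN orbT.
  rewrite mem_enum inE; eval_let.
    eapply evaluates_le.
      apply: (@runs_hierholzer R V C I N (size (plain_edges I)).*2.+2 [:: u]
        [::] (plain_edges I) CN sD).
      by rewrite /=; lia.
    instantiate (1 := ((2 * N + 2) * hierholzer_time N)%N).
    by rewrite leq_mul2r; apply/orP; right; lia.
  rewrite -/(euler_from (vcol I) (tcol I) u (plain_edges I)) -/(euler_centre I).
  eval_let.
    rewrite K0c; apply: evaluates_le (runs_split_circuit I x s) _.
    instantiate (1 := (100 * N + 100)%N).
    by have := congr1 size K0c; rewrite /=; lia.
  rewrite -K0c; eval_let.
    apply: evaluates_le (runs_circuits CN srest (leqnn _) _) _.
      by have := euler_fromP (balanced_plain_edges starI);
         rewrite -/(euler_centre I); case: (euler_centre I) => ? ? [].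
    instantiate (1 := (N * circuit_time N + 20)%N).
    by rewrite leq_add2r leq_mul2r srest orbT.
  eval_let; first exact: runs_plan.
  eval_call; exact: runs_swaps.
- rewrite /main_time /= K0E.
  rewrite /optimal_leaves /plan_leaves /other_circuits /= in sls sX sK.
  move: sls sX sK sZ; move: (size (plan _ _ _ _)) (size (excursions _)).
  move: (size K0) (size (flatten _)) (size Z) => k0 ks z p e.
  move: (N * (20 * N + 200))%N (N * (40 * N + 300))%N => a b.
  move: ((2 * N + 2) * _)%N (N * circuit_time N)%N => c d.
  clear; lia.
Qed.

Lemma optimal_leaves_optimal :
  optimal I (solves_coloured I) (centre_swaps u optimal_leaves).
Proof.
have sys := algorithm_system starI; split.
  by apply: plan_solves => //; apply: loopsP.
by move=> sigma'; apply: plan_optimal => //; apply: loopsP.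
Qed.

End Main.

Lemma star_swapping_polynomial : polynomial_time_solvable.
Proof.
have [k mk] := poly_bounded_main_time.
exists swap_program, k => R V C I starI.
have [t ev le] := runs_main starI.
exists (centre_swaps (centre I) (optimal_leaves I)), t; split=> //.
- exact: optimal_leaves_optimal.
- by apply: leq_trans le _; apply: mk.
Qed.

Theorem theorem6p8 :
  (forall (R : realFieldType) (V C : finType) (I : instance R V C),
    star_instance I ->
    [/\ (exists TA : V -> V, is_TA I TA),
        (forall T : V -> V, token_vertex_assignment I T ->
           exists x : R, Fcost I T x)
      & forall TA : V -> V, is_TA I TA ->
        [/\ token_vertex_assignment I TA,
            (forall sigma : seq (V * V),
               optimal I (solves_uncoloured I TA) sigma ->
               optimal I (solves_coloured I) sigma)
          & exists m : R,
            [/\ Fcost I TA m,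
                is_minimum (fun x : R => exists2 T : V -> V,
                  token_vertex_assignment I T & Fcost I T x) m
              & min_cost I (solves_coloured I) m]]])
  /\ polynomial_time_solvable.
Proof.
split; last exact: star_swapping_polynomial.
by move=> R V C I; apply: TA_optimal.
Qed.
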